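(* The zero locus in $OG(2,8)$ of a general global section of the spinor bundle $\mathcal{S}_+$ is isomorphic to $OG(2,7)$.
   Context: Over $\mathbb{C}$. $OG(k,m)$ is the orthogonal Grassmannian of isotropic $k$-dimensional subspaces of $\mathbb{C}^m$ with a non-degenerate quadratic form. Write $V=\mathbb{C}^8=E\oplus F$ with $E,F$ maximal isotropic, $F\simeq E^\vee$. The half-spin representations of $Spin_8$ are $\Delta_+=\wedge^{even}E$, $\Delta_-=\wedge^{odd}E$, with Clifford action $V\otimes\Delta_\pm\to\Delta_\mp$ ($E$ acts by wedge product, $F$ by contraction). The spinor bundle $\mathcal{S}_+$ on $OG(2,8)$ is the homogeneous bundle of rank $2$ whose fiber at $[U]$ is the cokernel of $U\otimes\Delta_-\to\Delta_+$; $H^0(\mathcal{S}_+)=\Delta_+$. *)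

(* Defs.v *)
From HB Require Import structures.
From mathcomp Require Import all_boot all_order all_algebra.
From mathcomp Require Import boolp classical_sets functions reals.
From mathcomp Require Import complex mpoly.

Set Implicit Arguments.
Unset Strict Implicit.
Unset Printing Implicit Defensive.

Import GRing.Theory.
Local Open Scope ring_scope.
Local Open Scope classical_set_scope.
Local Open Scope complex_scope.

(* Schemes over C := R[i] are given by their functors of points, that is by    *)
(* functors on commutative C-algebras, and isomorphisms of schemes over C are  *)
(* natural isomorphisms between these. All schemes considered here are closed  *)
(* subschemes of Grassmannians Gr(k, n), whose A-points are submodules of A^n; *)
(* a submodule is represented by its set of elements. The types comAlgType     *)
(* leave out the zero algebra, over which a scheme has exactly one point.      *)

Section GrassmannianFunctors.
Context {R : realType}.
Local Notation C := R[i].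

(* The B-submodule of B^n spanned by the image of U. For a direct summand U of *)
(* A^n this is the pullback of U, because B (x)_A U injects into B^n.          *)
Definition base_change {A B : comAlgType C} (f : {lrmorphism A -> B}) {n : nat}
    (U : set 'rV[A]_n) : set 'rV[B]_n :=
  [set y | exists (r : nat) (c : 'rV[B]_r) (M : 'M[A]_(r, n)),
     (forall i, U (row i M)) /\ y = c *m map_mx f M].

Record grass_functor (n : nat) := GrassFunctor {
  points : forall A : comAlgType C, set (set 'rV[A]_n);
  points_base_change : forall (A B : comAlgType C) (f : {lrmorphism A -> B})
    (U : set 'rV[A]_n), @points A U -> @points B (base_change f U) }.
Arguments points {n} X A : rename.

Definition isomorphic {m n : nat} (X : grass_functor m) (Y : grass_functor n) :
    Prop :=
  exists phi : forall A : comAlgType C, set 'rV[A]_m -> set 'rV[A]_n,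
    (forall A, set_bij (points X A) (points Y A) (phi A)) /\
    (forall (A B : comAlgType C) (f : {lrmorphism A -> B}) (U : set 'rV[A]_m),
       points X A U -> phi B (base_change f U) = base_change f (phi A U)).

(* Direct summands of A^n of constant rank k: the row spaces of idempotent     *)
(* matrices that have rank k at every field-valued point of Spec A.            *)
Definition summand (k : nat) {A : comAlgType C} {n : nat} (U : set 'rV[A]_n) :
    Prop :=
  exists P : 'M[A]_n,
    [/\ P *m P = P,
        U = range (fun x : 'rV[A]_n => x *m P)
      & forall (K : fieldType) (g : {rmorphism A -> K}),
          \rank (map_mx g P) = k].

Definition isotropic {n : nat} (Q : 'M[C]_n) {A : comAlgType C}
    (U : set 'rV[A]_n) : Prop :=
  forall u, U u -> u *m map_mx (in_alg A) Q *m u^T = 0.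

Lemma summand_base_change k n (A B : comAlgType C) (f : {lrmorphism A -> B})
    (U : set 'rV[A]_n) : summand k U -> summand k (base_change f U).
Proof.
move=> [P [PP -> rP]]; exists (map_mx f P); split.
- by rewrite -map_mxM PP.
- apply/seteqP; split => y.
    move=> [r [c [M [UM ->]]]].
    have {UM} [X ->] : exists X, M = X *m P.
      have [X XP] := choice (fun i => (let: ex_intro2 x _ e := UM i in
         ex_intro (fun x => x *m P = row i M) x e)).
      exists (\matrix_i X i); apply/row_matrixP => i.
      by rewrite row_mul rowK XP.
    by exists (c *m map_mx f X) => //; rewrite map_mxM mulmxA.
  move=> [x _ <-]; exists n, x, P; split=> // i.
  by exists (delta_mx 0 i) => //; rewrite -rowE.
- by move=> K g; rewrite -map_mx_comp; exact: (rP K (g \o f)).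
Qed.

Lemma isotropic_base_change k n (Q : 'M[C]_n) (A B : comAlgType C)
    (f : {lrmorphism A -> B}) (U : set 'rV[A]_n) :
  summand k U -> isotropic Q U -> isotropic Q (base_change f U).
Proof.
move=> [P [_ UE _]] isoU _ [r [c [M [UM ->]]]].
set QA := map_mx (in_alg A) Q in isoU.
have -> : map_mx (in_alg B) Q = map_mx f QA.
  by apply/matrixP => i j; rewrite !mxE /= rmorph_alg.
pose N := M *m QA *m M^T.
have NE i j : row i M *m QA *m (row j M)^T = (N i j)%:M.
  apply/matrixP => a b; rewrite !ord1 -row_mul !mxE eqxx mulr1n.
  by apply: eq_bigr => l _; rewrite !mxE.
have U0 u : U u -> u *m QA *m u^T = 0 by exact: isoU.
have N2 : N + N^T = 0.
  apply/matrixP => i j; rewrite !mxE.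
  have UD : U (row i M + row j M).
    have := UM j; have := UM i; rewrite UE => -[x _ xP] [y _ yP].
    by exists (x + y) => //; rewrite mulmxDl xP yP.
  have := U0 _ UD.
  rewrite linearD /= !mulmxDl !mulmxDr !U0 // add0r addr0 !NE.
  by move=> /matrixP/(_ 0 0); rewrite !mxE !eqxx !mulr1n addrC.
set S := _ *m _ *m _.
have SE : S = c *m map_mx f N *m c^T.
  by rewrite /S /N !map_mxM trmx_mul map_trmx !mulmxA.
have S2 : S *+ 2 = 0.
  have ST : S^T = S by apply/matrixP => a b; rewrite mxE !ord1.
  rewrite mulr2n -{2}ST SE !trmx_mul trmxK map_trmx mulmxA -mulmxDl -mulmxDr.
  by rewrite -map_mxD N2 map_mx0 mulmx0 mul0mx.
apply/matrixP => a b; rewrite !ord1 [RHS]mxE.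
have /matrixP/(_ 0 0) := S2; rewrite mulr2n !mxE -mulr2n.
move=> /(congr1 (fun z => (2%:R : C)^-1 *: z)).
rewrite scaler0 -scalerMnr scalerMnl -mulr_natr mulVf ?scale1r //.
by rewrite Num.Theory.pnatr_eq0.
Qed.

Definition OG_points (k : nat) {n : nat} (Q : 'M[C]_n) (A : comAlgType C) :
    set (set 'rV[A]_n) := [set U | summand k U /\ isotropic Q U].

Lemma OG_base_change k n (Q : 'M[C]_n) (A B : comAlgType C)
    (f : {lrmorphism A -> B}) (U : set 'rV[A]_n) :
  OG_points k Q U -> OG_points k Q (base_change f U).
Proof.
move=> [sU iU]; split; first exact: summand_base_change.
exact: isotropic_base_change sU iU.
Qed.

(* The orthogonal Grassmannian of the quadratic form u |-> u *m Q *m u^T.      *)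
Definition OG (k : nat) {n : nat} (Q : 'M[C]_n) : grass_functor n :=
  GrassFunctor (@OG_base_change k n Q).

End GrassmannianFunctors.

(* The exterior algebra of E (x) A, where E = C^4 has basis e_0, .., e_3: the  *)
(* value of x at I = {i_1 < .. < i_p} is the coordinate of x on                *)
(* e_I = e_{i_1} /\ .. /\ e_{i_p}.                                             *)
Definition exterior (A : Type) := {ffun {set 'I_4} -> A}.

Definition Delta_plus (A : nmodType) : set (exterior A) :=
  [set x | forall I : {set 'I_4}, odd #|I| -> x I = 0].

Definition Delta_minus (A : nmodType) : set (exterior A) :=
  [set x | forall I : {set 'I_4}, ~~ odd #|I| -> x I = 0].

Section Clifford.
Context {A : comNzRingType}.

(* For i \notin J, e_i /\ e_J = koszul_sign i J * e_(i |: J); dually, the       *)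
(* contraction of e_(i |: J) by f_i is koszul_sign i J * e_J.                  *)
Definition koszul_sign (i : 'I_4) (I : {set 'I_4}) : A :=
  (-1) ^+ #|[set j in I | (j < i)%N]|.

Definition wedge (i : 'I_4) (x : exterior A) : exterior A :=
  [ffun I : {set 'I_4} => if i \in I then koszul_sign i I * x (I :\ i) else 0].

Definition contract (i : 'I_4) (x : exterior A) : exterior A :=
  [ffun I : {set 'I_4} => if i \in I then 0 else koszul_sign i I * x (i |: I)].

(* A row of length 4 + 4 lists the coordinates on e_0, .., e_3 and on the dual *)
(* basis f_0, .., f_3 of F.                                                    *)
Definition clifford (v : 'rV[A]_(4 + 4)) (x : exterior A) : exterior A :=
  [ffun I => \sum_(i < 4) (v 0 (lshift 4 i) * wedge i x I
                            + v 0 (rshift 4 i) * contract i x I)].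

End Clifford.

Section SpinorBundle.
Context {R : realType}.
Local Notation C := R[i].

(* The duality pairing between E and F: v |-> v *m VQ *m v^T is 2 <e, f> at    *)
(* v = e + f.                                                                  *)
Definition VQ : 'M[C]_(4 + 4) := block_mx 0 1%:M 1%:M 0.

(* The image of U (x) Delta_- -> Delta_+, whose cokernel is the module of      *)
(* sections of the pullback of S_+ to Spec A along the A-point U of OG(2, 8).  *)
Definition spinor_relations {A : comAlgType C} (U : set 'rV[A]_(4 + 4)) :
    set (exterior A) :=
  [set x | exists (r : nat) (u : 'I_r -> 'rV[A]_(4 + 4)) (y : 'I_r -> exterior A),
     [/\ forall i, U (u i),
         forall i, Delta_minus (y i)
       & x = \sum_(i < r) clifford (u i) (y i)]].

Definition constant_spinor (s : exterior C) (A : comAlgType C) : exterior A :=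
  [ffun I => (s I)%:A].

Definition zero_locus_points (s : exterior C) (A : comAlgType C) :
    set (set 'rV[A]_(4 + 4)) :=
  [set U | OG_points 2 VQ U /\ spinor_relations U (constant_spinor s A)].

Lemma zero_locus_base_change (s : exterior C) (A B : comAlgType C)
    (f : {lrmorphism A -> B}) (U : set 'rV[A]_(4 + 4)) :
  zero_locus_points s U -> zero_locus_points s (base_change f U).
Proof.
move=> [OGU [r [u [y [Uu yD sE]]]]]; split; first exact: OG_base_change.
exists r, (fun i => map_mx f (u i)), (fun i => [ffun I => f (y i I)]); split.
- move=> i; exists 1%N, 1%:M, (u i); split; last by rewrite mul1mx.
  by move=> j; rewrite row_id.
- by move=> i I I_even; rewrite ffunE (yD i I I_even) rmorph0.
- apply/ffunP => I; rewrite ffunE sum_ffunE.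
  have /ffunP/(_ I) := sE; rewrite ffunE sum_ffunE => /(congr1 f).
  rewrite rmorph_alg => ->; rewrite rmorph_sum; apply: eq_bigr => j _.
  rewrite !ffunE rmorph_sum; apply: eq_bigr => l _.
  rewrite rmorphD !rmorphM !ffunE !mxE.
  by case: ifP => _; rewrite ?rmorph0 ?rmorphM ?rmorphXn ?rmorphN1.
Qed.

(* The zero scheme in OG(2, 8) of the global section of S_+ given by s.        *)
Definition zero_locus (s : exterior C) : grass_functor (4 + 4) :=
  GrassFunctor (@zero_locus_base_change s).

Definition zariski_open (G : set (exterior C)) : Prop :=
  exists ps : seq {mpoly C[#|{set 'I_4}|]},
    G = [set s | Delta_plus s /\
                 exists2 p, p \in ps & p.@[fun i => s (enum_val i)] != 0].

(* Delta_+ is irreducible, so its nonempty open subsets are dense.             *)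
Definition for_general_section (P : exterior C -> Prop) : Prop :=
  exists G : set (exterior C),
    [/\ zariski_open G, G !=set0 & forall s, G s -> P s].

End SpinorBundle.

(* Main.v *)
From HB Require Import structures.
Require Import Defs.
From mathcomp Require Import all_boot all_order all_algebra.
From mathcomp Require Import boolp classical_sets functions reals.
From mathcomp Require Import complex mpoly.
From mathcomp Require Import ring.

Set Implicit Arguments.
Unset Strict Implicit.
Unset Printing Implicit Defensive.

Import GRing.Theory.
Local Open Scope ring_scope.
Local Open Scope classical_set_scope.
Local Open Scope complex_scope.

(** A spinor s lies in the image U.Delta_- of the Clifford action iff it is
    orthogonal to the annihilator of U in Delta_+. By triality, taking
    annihilators is an isomorphism from OG(2, V) onto OG(2, Delta_+), with inverse
    given by the same construction. Hence, when q(s) <> 0, the zero locus of s is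
    OG(2, W) where W is the orthogonal of s, a nondegenerate quadratic space of
    dimension 7.

    In suitable coordinates V, Delta_+ and Delta_- are the split octonions, and
    the Clifford action is (v, y) |-> v y on Delta_- and (v, x) |-> conj(v) x on
    Delta_+. As conj(conj(v) x) = conj(x) v, the relation "v annihilates x" is
    symmetric, so V and Delta_+ play the same role.

    Over a C-algebra A, a point U of OG(2, 8) is the row space of an idempotent P
    of trace 2, and its annihilator is the row space of an explicit idempotent,
    polynomial in P (dual_projector); this gives naturality. The identities that
    hold because U has rank 2 are proved locally: at each residue field of A, some
    a that does not vanish there satisfies a P = X Y with X, Y of inner
    dimension 2. *)

(** * Vanishing at residue fields *)

Lemma residue_field (A : comNzRingType) (J : set A) :
    ~ J 1 -> J 0 -> (forall x y, J x -> J y -> J (x + y)) ->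
    (forall a x, J x -> J (a * x)) ->
    (forall x, ~ J x -> exists a, J (1 - a * x)) ->
  exists (K : fieldType) (g : {rmorphism A -> K}), forall x, J x -> g x = 0.
Proof.
move=> J1 J0 JD JM Jmax.
pose I : pred A := fun x => `[< J x >].
have I_ideal : idealr_closed I.
  split; [exact/asboolP|exact/asboolP|].
  by move=> a x y /asboolP Jx /asboolP Jy; apply/asboolP/JD => //; exact: JM.
pose IaM := GRing.isZmodClosed.Build _ I (idealr_closedB I_ideal).
pose IpM := isProperIdeal.Build _ I (idealr_closed_nontrivial I_ideal).
pose Iid : idealr _ := HB.pack I IaM IpM.
pose E : comNzRingType := {ideal_quot Iid}.
pose g : {rmorphism A -> E} := \pi_E%qT.
have g0 x : (g x == 0) = `[< J x >].
  by rewrite -(rmorph0 g) -Quotient.idealrBE subr0.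
have /choice[inv invP] (x : E) : exists y : E, x != 0 -> y * x = 1.
  have [->|] := eqVneq x 0; first by exists 0.
  rewrite -[x]reprK -/(g _) g0 => /asboolP /Jmax [a Ja].
  exists (g a) => _; apply/eqP.
  by rewrite eq_sym -subr_eq0 -(rmorph1 g) -rmorphM -rmorphB g0; apply/asboolP.
pose inv' x := if x == 0 then 0 else inv x.
have mulV x : x != 0 -> inv' x * x = 1.
  by move=> x0; rewrite /inv' (negPf x0) invP.
have inv0 : inv' 0 = 0 by rewrite /inv' eqxx.
pose KM := GRing.ComNzRing_isField.Build E mulV inv0.
pose K : fieldType := HB.pack E KM.
by exists K, g => x Jx; apply/eqP; rewrite g0; apply/asboolP.
Qed.

Lemma maximal_ideal_above (A : comNzRingType) (I : set A) :
    ~ I 1 -> I 0 -> (forall x y, I x -> I y -> I (x + y)) ->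
    (forall a x, I x -> I (a * x)) ->
  exists J : set A, I `<=` J /\
    [/\ ~ J 1, J 0, forall x y, J x -> J y -> J (x + y),
        forall a x, J x -> J (a * x) & forall x, ~ J x -> exists a, J (1 - a * x)].
Proof.
move=> I1 I0 ID IM.
pose proper (J : set A) := [/\ I `<=` J, ~ J 1,
  forall x y, J x -> J y -> J (x + y) & forall a x, J x -> J (a * x)].
have Iproper : proper I by split.
have [F FP Ftot|J [JP Jmax]] := @Zorn_bigcup A [set J | J = set0 \/ proper J].
  have [F0|/existsNP[G0 /not_implyP[FG0 G0n]]] :=
    pselect (forall G, F G -> G = set0).
    left; apply/seteqP; split=> // x [G FG]; by rewrite (F0 _ FG).
  have pr G : F G -> G !=set0 -> proper G.
    by move=> FG [x Gx]; case: (FP _ FG) => // GE; move: Gx; rewrite GE.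
  right; split.
  - move=> x Ix; exists G0 => //; case: (FP _ FG0) => // -[GI _ _ _].
    exact: GI.
  - by move=> [G FG G1]; have [|_ /(_ G1)] := pr G FG; first by exists 1.
  - move=> x y [G FG Gx] [H FH Hy].
    have [GH|HG] := Ftot _ _ FG FH.
      exists H => //; have [|_ _ + _] := pr H FH; first by exists y.
      by apply=> //; exact: GH.
    exists G => //; have [|_ _ + _] := pr G FG; first by exists x.
    by apply=> //; exact: HG.
  - move=> a x [G FG Gx]; exists G => //.
    by have [|_ _ _] := pr G FG; [exists x|apply].
have {JP} [JI J1 JD JM] : proper J.
  case: JP => // JE; exfalso; apply: (Jmax I); last by right.
  by rewrite JE; split=> // /(_ 0 I0).
exists J; split=> //; split=> //; first exact: JI.
move=> x nJx; have [a [j [Jj ->]]] : exists a j, J j /\ 1 = j + a * x; last first.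
  by exists a; rewrite addrK.
apply: contrapT => no.
  apply: (Jmax [set y | exists a j, J j /\ y = j + a * x]).
    split=> [j Jj|]; first by exists 0, j; rewrite mul0r addr0.
    move=> sub; apply/nJx/sub; exists 1, 0; rewrite add0r mul1r.
    by split=> //; exact: JI.
  right; split=> //.
  - by move=> y /JI Jy; exists 0, y; rewrite mul0r addr0.
  - move=> y z [a [j [Jj ->]]] [b [k [Jk ->]]]; exists (a + b), (j + k).
    by split; [exact: JD|rewrite mulrDl addrACA].
  - move=> c y [a [j [Jj ->]]]; exists (c * a), (c * j).
    by split; [exact: JM|rewrite mulrDr mulrA].
Qed.

(** If the annihilator of [z] were a proper ideal, it would lie in a maximal one, at whose residue
    field every [a] killing [z] vanishes. *)
Lemma local_eq0 (A : comNzRingType) (z : A) :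
    (forall (K : fieldType) (g : {rmorphism A -> K}),
       exists2 a, g a != 0 & a * z = 0) ->
  z = 0.
Proof.
move=> loc; apply: contrapT => nz.
have [|||a x /=|J [JI [J1 J0 JD JM Jp]]] := @maximal_ideal_above A [set a | a * z = 0].
- by rewrite /= mul1r.
- by rewrite /= mul0r.
- by move=> x y /= x0 y0; rewrite mulrDl x0 y0 addr0.
- by rewrite -mulrA => ->; rewrite mulr0.
have [K [g gJ]] := residue_field J1 J0 JD JM Jp.
by have [a /eqP ga az] := loc K g; apply/ga/gJ/JI.
Qed.

(** * Idempotent matrices of constant rank *)

Lemma unit_minor (K : fieldType) m n (M : 'M[K]_(m, n)) :
  exists (f : 'I_(\rank M) -> 'I_m) (h : 'I_(\rank M) -> 'I_n),
    mxsub f h M \in unitmx.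
Proof.
have fR : row_full (rowsub (maxrankfun M) M)^T.
  by rewrite /row_full mxrank_tr; exact: maxrowsub_free.
exists (maxrankfun M), (fullrankfun fR).
rewrite -unitmx_tr; suff -> : (mxsub (maxrankfun M) (fullrankfun fR) M)^T
    = rowsub (fullrankfun fR) (rowsub (maxrankfun M) M)^T.
  exact: fullrowsub_unit.
by apply/matrixP => i j; rewrite !mxE.
Qed.

(** For a minor [D] invertible at [g], of determinant [d], both [Pi] and [W = d P - Pi] satisfy
    [Z^2 = d Z], and [W] vanishes at [g]. Then [b = det (d - W)] kills [W] and does not vanish at
    [g], so [b d P = b Pi], which factors through dimension [k]. *)
Lemma local_frame (A : comNzRingType) n k (P : 'M[A]_n) (K : fieldType)
    (g : {rmorphism A -> K}) :
  P *m P = P -> \rank (map_mx g P) = k ->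
  exists (a : A) (X : 'M_(n, k)) (Y : 'M_(k, n)),
    [/\ g a != 0, a *: P = X *m Y, Y *m X = a%:M & Y *m P = Y].
Proof.
move=> PP <-; have [f [h Du]] := unit_minor (map_mx g P).
set D := mxsub f h P.
set X := colsub h P; set Y := rowsub f P.
have PX : P *m X = X by rewrite mulmx_colsub PP.
have YP : Y *m P = Y by rewrite mul_rowsub_mx PP.
have YX : Y *m X = D.
  by rewrite mulmx_colsub YP; apply/matrixP => i j; rewrite !mxE.
pose d := \det D; pose Pi := X *m \adj D *m Y.
have gd : g d != 0.
  by move: Du; rewrite unitmxE unitfE -map_mxsub det_map_mx.
have PiPi : Pi *m Pi = d *: Pi.
  rewrite /Pi !mulmxA -(mulmxA _ Y) YX -(mulmxA X) mul_adj_mx.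
  by rewrite mul_mx_scalar -!scalemxAl.
pose W := d *: P - Pi.
have WW : W *m W = d *: W.
  have PPi : P *m Pi = Pi by rewrite /Pi !mulmxA PX.
  have PiP : Pi *m P = Pi by rewrite /Pi -mulmxA YP.
  rewrite /W mulmxBl !mulmxBr -!scalemxAl -!scalemxAr PP PPi PiP PiPi scalerBr.
  by rewrite subrr subr0.
(* At [g] the rows of [Y] span the row space of [P], so [P] factors through [Y] there and [Pi]
   becomes [d P]. *)
have gW : map_mx g W = 0.
  have /submxP[C PC] : (map_mx g P <= map_mx g Y)%MS.
    have YPs : (map_mx g Y <= map_mx g P)%MS by rewrite -YP map_mxM submxMl.
    rewrite -(geq_leqif (mxrank_leqif_sup YPs)).
    rewrite -{1}(mxrank_unit Du) -map_mxsub -/D -YX map_mxM.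
    exact: mxrankM_maxl.
  have CD : map_mx g X = C *m map_mx g D.
    by rewrite -YX map_mxM mulmxA -PC -map_mxM PX.
  rewrite map_mxB map_mxZ !map_mxM CD -!mulmxA (mulmxA (map_mx g D)).
  rewrite -map_mxM mul_mx_adj map_scalar_mx mul_scalar_mx -scalemxAr -PC.
  by rewrite subrr.
pose b := \det (d%:M - W).
have bW : b *: W = 0.
  rewrite -mul_scalar_mx -mul_adj_mx -mulmxA mulmxBl mul_scalar_mx WW subrr.
  by rewrite mulmx0.
have gb : g b = g d ^+ n.
  by rewrite -det_map_mx map_mxB gW subr0 map_scalar_mx det_scalar.
exists (b * d), (b *: (X *m \adj D)), Y; split=> //.
- by rewrite rmorphM gb -exprSr expf_neq0.
- rewrite -scalemxAl -/Pi -scalerA -[d *: P](subrK Pi) -/W.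
  by rewrite scalerDr bW add0r.
- by rewrite -scalemxAr mulmxA YX mul_mx_adj scale_scalar_mx.
Qed.

Lemma tr_idempotent (K : fieldType) n (P : 'M[K]_n) :
  P *m P = P -> \tr P = (\rank P)%:R.
Proof.
move=> PP; have [|a [X [Y [/= a0 aP YX _]]]] := @local_frame K n (\rank P) P K idfun PP.
  by rewrite map_mx_id.
by apply: (mulfI a0); rewrite -mxtraceZ aP mxtrace_mulC YX mxtrace_scalar mulr_natr.
Qed.

(** * Summands as row spaces of idempotents of given trace *)

Section Projectors.
Variables (R : realType).
Local Notation C := R[i].

(** Positive integers are invertible in [C], hence in [A] and in [K]; so the trace of an idempotent
    over [K] determines its rank. *)
Lemma natr_alg_inj (A : comAlgType C) (K : fieldType) (g : {rmorphism A -> K}) :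
  injective (fun n : nat => n%:R : K).
Proof.
have nz k : (k%:R == 0 :> K) = (k == 0).
  have [->|k0] := eqVneq k 0; first exact: eqxx.
  apply/negP => /eqP e; suff : g (in_alg A (k%:R : C) * in_alg A (k%:R : C)^-1) = 0.
    rewrite -rmorphM mulfV ?Num.Theory.pnatr_eq0 // !rmorph1.
    exact/eqP/oner_neq0.
  by rewrite rmorphM /= [X in g X * _](rmorph_nat (in_alg A)) rmorph_nat e mul0r.
move=> m n /=; wlog le_mn : m n / (m <= n)%N.
  by move=> H e; case: (leqP m n) => [/H->//|/ltnW/H->].
move=> /esym/eqP; rewrite -subr_eq0 -natrB // nz subn_eq0 => le_nm.
by apply/eqP; rewrite eqn_leq le_mn.
Qed.

(** The trace stands in for the rank at all residue fields ([summandP]): it is an equation over [A],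
    preserved by ring morphisms. *)
Definition projector (A : comAlgType C) n (k : nat) (P : 'M[A]_n) : Prop :=
  P *m P = P /\ \tr P = k%:R.

Lemma projector_map (A B : comAlgType C) (f : {rmorphism A -> B}) n k (P : 'M[A]_n) :
  projector k P -> projector k (map_mx f P).
Proof.
by move=> [PP tP]; split; rewrite -?map_mxM ?PP // trace_map_mx tP rmorph_nat.
Qed.

Lemma projector_rank (A : comAlgType C) n k (P : 'M[A]_n) (K : fieldType)
  (g : {rmorphism A -> K}) : projector k P -> \rank (map_mx g P) = k.
Proof.
move=> [PP tP]; apply: (natr_alg_inj g).
by rewrite /= -tr_idempotent -?map_mxM ?PP // trace_map_mx tP rmorph_nat.
Qed.

Lemma projector0 (A : comAlgType C) n (P : 'M[A]_n) : projector 0 P -> P = 0.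
Proof.
move=> P0; apply/matrixP => i j; rewrite mxE; apply: local_eq0 => K g.
have [|a [X [Y [ga aP _ _]]]] := @local_frame A n 0 P K g P0.1.
  exact: projector_rank P0.
exists a => //; have /matrixP/(_ i j) := aP.
by rewrite mxE => ->; rewrite mxE big_ord0.
Qed.

Definition rowspace (A : pzSemiRingType) n (P : 'M[A]_n) : set 'rV[A]_n :=
  range (fun x => x *m P).

Lemma rowspaceP (A : comNzRingType) n (P : 'M[A]_n) x :
  P *m P = P -> rowspace P x <-> x *m P = x.
Proof.
move=> PP; split=> [[y _ <-]|e]; first by rewrite -mulmxA PP.
by exists x.
Qed.

Lemma rowspace_sub (A : comNzRingType) n (P P' : 'M[A]_n) :
  P' *m P' = P' -> rowspace P `<=` rowspace P' -> P *m P' = P.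
Proof.
move=> PP sub; apply/row_matrixP => i; rewrite row_mul; apply/(rowspaceP _ PP).
by apply: sub; exists (delta_mx 0 i); rewrite // rowE.
Qed.

(** [P' - P' *m P] is an idempotent of trace [k - k], hence zero by [projector0]. *)
Lemma projector_eq (A : comAlgType C) n k (P P' : 'M[A]_n) :
  projector k P -> projector k P' -> rowspace P `<=` rowspace P' ->
  rowspace P = rowspace P'.
Proof.
move=> [PP tP] [PP' tP'] /(rowspace_sub PP') PP'E.
suff /eqP : P' - P' *m P = 0.
  rewrite subr_eq0 => /eqP e; apply/seteqP; split=> _ [x _ <-].
    by exists (x *m P); rewrite // -mulmxA PP'E.
  by exists (x *m P'); rewrite // -mulmxA -e.
apply: projector0; split.
  rewrite mulmxBl !mulmxBr PP' !mulmxA PP' -(mulmxA P' P P') PP'E.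
  by rewrite -(mulmxA P' P P) PP subrr subr0.
by rewrite raddfB /= mxtrace_mulC PP'E tP tP' subrr.
Qed.

(** Locally [a P = X Y] and [Y X = a] in size [k], so that [a (tr P - k) = 0]. *)
Lemma summandP (A : comAlgType C) n k (U : set 'rV[A]_n) :
  summand k U <-> exists2 P, projector k P & U = rowspace P.
Proof.
split=> [[P [PP UE rP]]|[P pP UE]]; exists P => //; last first.
  by split=> //; [case: pP|move=> K g; apply: projector_rank pP].
split=> //; apply/eqP; rewrite -subr_eq0; apply/eqP/local_eq0 => K g.
have [a [X [Y [ga aP YX _]]]] := local_frame PP (rP K g).
exists a; rewrite // mulrBr -mxtraceZ aP mxtrace_mulC YX mxtrace_scalar.
by rewrite mulr_natr subrr.
Qed.

Lemma rowspace_base_change (A B : comAlgType C) (f : {lrmorphism A -> B}) n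
    (P : 'M[A]_n) : base_change f (rowspace P) = rowspace (map_mx f P).
Proof.
apply/seteqP; split => y.
  move=> [r [c [M [UM ->]]]].
  have [X XP] := choice (fun i => (let: ex_intro2 x _ e := UM i in
    ex_intro (fun x => x *m P = row i M) x e)).
  exists (c *m map_mx f (\matrix_i X i)) => //.
  rewrite -mulmxA -map_mxM; congr (_ *m map_mx f _).
  by apply/row_matrixP => i; rewrite row_mul rowK XP.
move=> [x _ <-]; exists n, x, P; split=> // i.
by exists (delta_mx 0 i) => //; rewrite -rowE.
Qed.

End Projectors.

(** * Split octonions *)

Section SplitOctonions.
Variable A : comNzRingType.
Implicit Types v w x y : 'rV[A]_(4 + 4).

Definition entry v (k : nat) : A := v 0 (inord k : 'I_(4 + 4)).

Definition row8 (s : seq A) : 'rV[A]_(4 + 4) := \row_k s`_k.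

Lemma entry_row8 s k : (k < 8)%N -> entry (row8 s) k = s`_k.
Proof. by move=> k8; rewrite /entry mxE inordK. Qed.

Lemma eq_entries v w : (forall k, (k < 8)%N -> entry v k = entry w k) -> v = w.
Proof.
move=> e; apply/rowP => k; have := e k (ltn_ord k); rewrite /entry.
by rewrite (_ : inord k = k) //; apply/val_inj; rewrite /= inordK ?ltn_ord.
Qed.

Lemma entryD v w k : entry (v + w) k = entry v k + entry w k.
Proof. by rewrite /entry mxE. Qed.

Lemma entryZ a v k : entry (a *: v) k = a * entry v k.
Proof. by rewrite /entry mxE. Qed.

Local Notation "v # k" := (entry v k%N) (at level 2).

(* Zorn's vector matrices ((a, u), (w, b)), of norm a b - u . w, with a = v # 0, *)
(* u = (v # 1, v # 2, v # 3), b = v # 4 and w = - (v # 5, v # 6, v # 7).        *)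
Definition omul v y : 'rV[A]_(4 + 4) := row8
  [:: v # 0 * y # 0 - v # 1 * y # 5 - v # 2 * y # 6 - v # 3 * y # 7;
      v # 0 * y # 1 + v # 1 * y # 4 - v # 6 * y # 7 + v # 7 * y # 6;
      v # 0 * y # 2 + v # 2 * y # 4 + v # 5 * y # 7 - v # 7 * y # 5;
      v # 0 * y # 3 + v # 3 * y # 4 - v # 5 * y # 6 + v # 6 * y # 5;
      v # 4 * y # 4 - v # 5 * y # 1 - v # 6 * y # 2 - v # 7 * y # 3;
      v # 3 * y # 2 - v # 2 * y # 3 + v # 4 * y # 5 + v # 5 * y # 0;
      v # 1 * y # 3 - v # 3 * y # 1 + v # 4 * y # 6 + v # 6 * y # 0;
      v # 2 * y # 1 - v # 1 * y # 2 + v # 4 * y # 7 + v # 7 * y # 0].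

Definition oconj v : 'rV[A]_(4 + 4) := row8
  [:: v # 4; - v # 1; - v # 2; - v # 3; v # 0; - v # 5; - v # 6; - v # 7].

Definition onorm v : A :=
  v # 0 * v # 4 + v # 1 * v # 5 + v # 2 * v # 6 + v # 3 * v # 7.

(** The polar form of [onorm] ([onormD]). *)
Definition opair v w : A :=
  v # 0 * w # 4 + v # 1 * w # 5 + v # 2 * w # 6 + v # 3 * w # 7 +
  (v # 4 * w # 0 + v # 5 * w # 1 + v # 6 * w # 2 + v # 7 * w # 3).

Ltac octonion := apply: eq_entries; do 8?[case=> [_|];
  [rewrite ?(entryD, entryZ, entry_row8) //= /onorm;
   rewrite ?(entryD, entryZ, entry_row8) //=; ring|]] => //.

Lemma omulDr a v y z : omul v (a *: y + z) = a *: omul v y + omul v z.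
Proof. octonion. Qed.

Lemma omulDl a v w y : omul (a *: v + w) y = a *: omul v y + omul w y.
Proof. octonion. Qed.

Lemma oconjK v : oconj (oconj v) = v.
Proof. octonion. Qed.

Lemma oconjD a v w : oconj (a *: v + w) = a *: oconj v + oconj w.
Proof. octonion. Qed.

Lemma oconjM v y : oconj (omul v y) = omul (oconj y) (oconj v).
Proof. octonion. Qed.

(** A form of the left alternative law; the Clifford relations below are its consequences. *)
Lemma omulK v y : omul (oconj v) (omul v y) = onorm v *: y.
Proof. octonion. Qed.

Lemma onorm_conj v : onorm (oconj v) = onorm v.
Proof. by rewrite /onorm !entry_row8 //=; ring. Qed.

Lemma opair_diag v : opair v v = 2%:R * onorm v.
Proof. by rewrite /opair /onorm; ring. Qed.

Lemma onormD v w : onorm (v + w) = onorm v + onorm w + opair v w.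
Proof. by rewrite /onorm /opair !entryD; ring. Qed.

Lemma opair_omul v y x : opair (omul v y) x = opair y (omul (oconj v) x).
Proof. by rewrite /opair !entry_row8 //=; ring. Qed.

HB.instance Definition _ v := GRing.isLinear.Build A _ _ _ (omul v)
  (fun a y z => omulDr a v y z).
HB.instance Definition _ := GRing.isLinear.Build A _ _ _ oconj oconjD.

End SplitOctonions.

(** * Clifford algebra of the octonion norm *)

Section CliffordAlgebra.
Variable A : comNzRingType.
Implicit Types a b c d v w x y : 'rV[A]_(4 + 4).

(* The Clifford actions of v on Delta_- (gammaN) and on Delta_+ (gammaM), as     *)
(* matrices acting on rows: in a product the leftmost factor acts first.        *)
Definition gammaN v : 'M[A]_(4 + 4) := lin1_mx (omul v).
Definition gammaM v : 'M[A]_(4 + 4) := lin1_mx (omul (oconj v)).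

Local Notation N := gammaN.
Local Notation M := gammaM.

Lemma mul_gammaN v y : y *m N v = omul v y.
Proof. by rewrite mul_rV_lin1. Qed.

Lemma mul_gammaM v x : x *m M v = omul (oconj v) x.
Proof. by rewrite mul_rV_lin1. Qed.

Lemma eq_mulmx (P P' : 'M[A]_(4 + 4)) :
  (forall x : 'rV_(4 + 4), x *m P = x *m P') -> P = P'.
Proof. by move=> e; apply/row_matrixP => i; rewrite !rowE. Qed.

Lemma gammaN_linear : linear N.
Proof.
move=> k v w; apply: eq_mulmx => x.
by rewrite mulmxDr -scalemxAr !mul_gammaN omulDl.
Qed.
HB.instance Definition _ := GRing.isLinear.Build A _ _ _ N gammaN_linear.

Lemma gammaM_linear : linear M.
Proof.
move=> k v w; apply: eq_mulmx => x.
by rewrite mulmxDr -scalemxAr !mul_gammaM linearP omulDl.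
Qed.
HB.instance Definition _ := GRing.isLinear.Build A _ _ _ M gammaM_linear.

Lemma gammaNZ k v : N (k *: v) = k *: N v.
Proof. exact: linearZ. Qed.

Lemma gammaMZ k v : M (k *: v) = k *: M v.
Proof. exact: linearZ. Qed.

Lemma gammaNM v : N v *m M v = (onorm v)%:M.
Proof.
apply: eq_mulmx => x.
by rewrite mulmxA mul_gammaN mul_gammaM omulK mul_mx_scalar.
Qed.

Lemma gammaMN v : M v *m N v = (onorm v)%:M.
Proof.
apply: eq_mulmx => x; rewrite mulmxA mul_gammaN mul_gammaM mul_mx_scalar.
by rewrite -{1}(oconjK v) omulK onorm_conj.
Qed.

Lemma onormD_scalar v w : (onorm (v + w))%:M =
  (onorm v)%:M + (onorm w)%:M + (opair v w)%:M :> 'M[A]_(4 + 4).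
Proof. by rewrite onormD; move: (onorm v) (onorm w) => ? ?; rewrite !raddfD. Qed.

(** Polarization of [gammaNM], written as a rule for exchanging two factors. *)
Lemma cliffordNM v w : N v *m M w = (opair v w)%:M - N w *m M v.
Proof.
apply/eqP; rewrite -[X in _ == X - _](addKr ((onorm v)%:M + (onorm w)%:M)).
rewrite -onormD_scalar -(gammaNM (v + w)) (raddfD N) (raddfD M) mulmxDl.
rewrite !mulmxDr !gammaNM.
by rewrite eq_sym subr_eq (addrC (_ w *m _ v)) addrACA addKr.
Qed.

Lemma cliffordMN v w : M v *m N w = (opair v w)%:M - M w *m N v.
Proof.
apply/eqP; rewrite -[X in _ == X - _](addKr ((onorm v)%:M + (onorm w)%:M)).
rewrite -onormD_scalar -(gammaMN (v + w)) (raddfD M) (raddfD N) mulmxDl.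
rewrite !mulmxDr !gammaMN.
by rewrite eq_sym subr_eq (addrC (_ w *m _ v)) addrACA addKr.
Qed.

Lemma anticommNM v w : N v *m M w + N w *m M v = (opair v w)%:M.
Proof. by rewrite cliffordNM addrNK. Qed.

Lemma anticommMN v w : M v *m N w + M w *m N v = (opair v w)%:M.
Proof. by rewrite cliffordMN addrNK. Qed.

Definition hyperbolic : 'M[A]_(4 + 4) := block_mx 0 1%:M 1%:M 0.
Local Notation J := hyperbolic.

Lemma hyperbolicK : J *m J = 1%:M.
Proof.
rewrite mulmx_block !mul0mx !mulmx0 !mulmx1 !addr0 !add0r.
by rewrite -scalar_mx_block.
Qed.

Lemma tr_hyperbolic : J^T = J.
Proof. by rewrite tr_block_mx !trmx0 !trmx1. Qed.

Lemma hyperbolicE v w : v *m J *m w^T = (opair v w)%:M.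
Proof.
rewrite -[v in LHS]hsubmxK -[w in LHS]hsubmxK tr_row_mx.
rewrite (@mul_row_block A 1 4 4 4 4) !mulmx0 !mulmx1 add0r addr0 mul_row_col.
apply/matrixP => i j; rewrite !ord1 !mxE !big_ord_recl !big_ord0 /opair /entry.
rewrite !mxE eqxx mulr1n !addr0 addrC !addrA.
do ![congr (_ + _)|congr (_ * _)]; congr (_ 0 _).
all: by apply/val_inj; rewrite /= inordK.
Qed.

Lemma opairC v w : opair v w = opair w v.
Proof.
have /matrixP/(_ 0 0) : (v *m J *m w^T)^T = w *m J *m v^T.
  by rewrite !trmx_mul trmxK tr_hyperbolic mulmxA.
by rewrite !hyperbolicE !mxE.
Qed.

Lemma opair_linear v : linear (opair v : _ -> A^o).
Proof.
move=> k w x; have /matrixP/(_ 0 0) := hyperbolicE v (k *: w + x).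
rewrite linearP /= mulmxDr -scalemxAr !hyperbolicE !mxE eqxx !mulr1n => <-.
by [].
Qed.
HB.instance Definition _ v := GRing.isLinear.Build A _ A^o _ (opair v) (opair_linear v).

(** The rows of [J] form the basis dual to the standard one; sums over such pairs serve as
    contractions below. *)
Lemma opair_row v k : opair v (row k J) = v 0 k.
Proof.
have /matrixP/(_ 0 0) := hyperbolicE v (row k J); rewrite [RHS]mxE mulr1n => <-.
rewrite [row k J]rowE trmx_mul tr_hyperbolic mulmxA -(mulmxA v) hyperbolicK.
by rewrite mulmx1 trmx_delta -colE mxE.
Qed.

Lemma gamma_adj v : N v *m J = J *m (M v)^T.
Proof.
apply: eq_mulmx => x; apply/matrixP => i j; rewrite ord1.
have /matrixP/(_ 0 0) := hyperbolicE (omul v x) (delta_mx 0 j).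
have /matrixP/(_ 0 0) := hyperbolicE x (omul (oconj v) (delta_mx 0 j)).
rewrite opair_omul => <-.
rewrite -mul_gammaN -mul_gammaM trmx_mul !mulmxA !trmx_delta -!colE !mxE => ->.
by [].
Qed.

End CliffordAlgebra.

(** * Traces of products of two and four Clifford operators *)

Section Traces.
Variables (A : comNzRingType) (half : A).
Hypothesis half2 : half * 2%:R = 1.
Implicit Types a b c d v w x y : 'rV[A]_(4 + 4).
Local Notation N := (@gammaN A).
Local Notation M := (@gammaM A).
Local Notation J := (@hyperbolic A).

Lemma mul2_inj : injective (fun x : A => 2%:R * x).
Proof. by apply: (can_inj (g := *%R half)) => x; rewrite mulrA half2 mul1r. Qed.

Lemma mul4_inj : injective (fun x : A => 4%:R * x).
Proof.
by move=> x y; rewrite [4%:R](natrM _ 2 2) -!mulrA => /mul2_inj/mul2_inj.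
Qed.

Lemma trace_scalar8 (x : A) : \tr (x%:M : 'M_(4 + 4)) = 8%:R * x.
Proof. by rewrite mxtrace_scalar mulr_natl. Qed.

(** Transposition and [gamma_adj] show that the trace is symmetric in [v] and [w]; by the Clifford
    relation the two traces add up to [8 opair v w]. *)
Lemma trMN v w : \tr (M v *m N w) = 4%:R * opair v w.
Proof.
apply: mul2_inj => /=; rewrite mulrA -natrM mulr_natl mulr2n.
have {1}-> : \tr (M v *m N w) = \tr (M w *m N v).
  rewrite -mxtrace_tr trmx_mul mxtrace_mulC.
  have -> : (M v)^T = J *m N v *m J.
    by rewrite -mulmxA gamma_adj mulmxA hyperbolicK mul1mx.
  have -> : (N w)^T = J *m M w *m J.
    rewrite -{1}(trmxK (M w)) -{1}[J]tr_hyperbolic -trmx_mul.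
    rewrite -[J]tr_hyperbolic -trmx_mul; congr trmx.
    by rewrite mulmxA -gamma_adj -mulmxA tr_hyperbolic hyperbolicK mulmx1.
  rewrite mxtrace_mulC !mulmxA -(mulmxA _ J J) hyperbolicK mulmx1.
  by rewrite mxtrace_mulC !mulmxA hyperbolicK mul1mx.
by rewrite cliffordMN raddfB /= trace_scalar8 opairC addrNK.
Qed.

Lemma trNM v w : \tr (N v *m M w) = 4%:R * opair v w.
Proof. by rewrite mxtrace_mulC trMN opairC. Qed.

Local Notation e k := (delta_mx 0 k : 'rV[A]_(4 + 4)).
Local Notation w k := (row k J).

(** The tensor [sum_k e_k (x) w_k] is symmetric because [J] is. *)
Lemma sum_dual_swap (F G : {linear 'rV[A]_(4 + 4) -> 'M[A]_(4 + 4)}) :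
  \sum_k F (e k) *m G (w k) = \sum_k F (w k) *m G (e k).
Proof.
have wE k : w k = \sum_l J k l *: e l.
  by rewrite {1}(row_sum_delta (w k)); apply: eq_bigr => l _; rewrite mxE.
under eq_bigr => k _ do rewrite wE linear_sum mulmx_sumr.
under [RHS]eq_bigr => k _ do rewrite wE linear_sum mulmx_suml.
rewrite exchange_big; apply: eq_bigr => k _; apply: eq_bigr => l _ /=.
rewrite !linearZ /= -scalemxAl; congr (_ *: _).
by rewrite -{1}tr_hyperbolic mxE.
Qed.

Lemma scale2_inj (X Y : 'M[A]_(4 + 4)) : X + X = Y + Y -> X = Y.
Proof.
move=> /matrixP XY; apply/matrixP => i j; apply: mul2_inj => /=.
by have := XY i j; rewrite !mxE /= !mulr_natl !mulr2n.
Qed.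

(** Adding the sum with [e] and [w] exchanged gives eight anticommutators equal to 1, and 4 is half
    of 8. *)
Lemma sum_NM : \sum_k N (e k) *m M (w k) = (4%:R)%:M.
Proof.
apply: scale2_inj; rewrite {2}sum_dual_swap -big_split /=.
rewrite (eq_bigr (fun=> 1%:M)) => [|k _]; last first.
  by rewrite anticommNM opair_row mxE !eqxx.
by rewrite sumr_const card_ord -raddfMn -raddfD /= -natrD.
Qed.

Lemma sum_MN : \sum_k M (w k) *m N (e k) = (4%:R)%:M.
Proof.
apply: scale2_inj; rewrite -{1}sum_dual_swap -big_split /=.
rewrite (eq_bigr (fun=> 1%:M)) => [|k _]; last first.
  by rewrite anticommMN opair_row mxE !eqxx.
by rewrite sumr_const card_ord -raddfMn -raddfD /= -natrD.
Qed.

(** Contractions over dual bases around [X]. Anticommuting the last factor of the argument past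
    [w k] gives the recursions [K1N] and [K2M]. *)
Let K1 (X : 'M[A]_(4 + 4)) : 'M[A]_(4 + 4) := \sum_k N (e k) *m X *m M (w k).
Let K2 (X : 'M[A]_(4 + 4)) : 'M[A]_(4 + 4) := \sum_k N (e k) *m X *m N (w k).

Lemma sum_coords (F : {linear 'rV[A]_(4 + 4) -> 'M[A]_(4 + 4)}) v (X : 'M[A]_(4 + 4)) :
  \sum_k v 0 k *: (F (e k) *m X) = F v *m X.
Proof.
rewrite {2}(row_sum_delta v) linear_sum mulmx_suml.
by apply: eq_bigr => k _; rewrite linearZ /= scalemxAl.
Qed.

Let K1N X d : K1 (X *m N d) = N d *m X - K2 X *m M d.
Proof.
rewrite /K1 /K2 mulmx_suml -(sum_coords N d X) -sumrB; apply: eq_bigr => k _.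
rewrite !mulmxA -(mulmxA _ (N d)) cliffordNM opair_row mulmxBr mul_mx_scalar.
by rewrite !mulmxA.
Qed.

Let K2M X d : K2 (X *m M d) = N d *m X - K1 X *m N d.
Proof.
rewrite /K1 /K2 mulmx_suml -(sum_coords N d X) -sumrB; apply: eq_bigr => k _.
rewrite !mulmxA -(mulmxA _ (M d)) cliffordMN opair_row mulmxBr mul_mx_scalar.
by rewrite !mulmxA.
Qed.

Let K1_1 : K1 1%:M = (4%:R)%:M.
Proof. by rewrite /K1; under eq_bigr => k _ do rewrite mulmx1; exact: sum_NM. Qed.

Let tMN a b c d := \tr (M a *m N b *m M c *m N d).
Let tNM a b c d := \tr (N a *m M b *m N c *m M d).

Let tNMC a b c d : tNM a b c d = tMN b c d a.
Proof. by rewrite /tNM -!mulmxA mxtrace_mulC !mulmxA. Qed.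

Let tNM_swap12 a b c d :
  tNM a b c d = 4%:R * opair a b * opair c d - tNM b a c d.
Proof.
rewrite /tNM cliffordNM !mulmxBl mul_scalar_mx -!scalemxAl raddfB /= mxtraceZ trNM.
by congr (_ - _); ring.
Qed.

Let tMN_swap12 a b c d :
  tMN a b c d = 4%:R * opair a b * opair c d - tMN b a c d.
Proof.
rewrite /tMN cliffordMN !mulmxBl mul_scalar_mx -!scalemxAl raddfB /= mxtraceZ trMN.
by congr (_ - _); ring.
Qed.

Let tNM_swap23 a b c d :
  tNM a b c d = 4%:R * opair b c * opair a d - tNM a c b d.
Proof.
rewrite /tNM -(mulmxA (N a)) cliffordMN mulmxBr mulmxBl mul_mx_scalar -!scalemxAl.
by rewrite raddfB /= mxtraceZ trNM !mulmxA; congr (_ - _); ring.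
Qed.

Let tMN_swap23 a b c d :
  tMN a b c d = 4%:R * opair b c * opair a d - tMN a c b d.
Proof.
rewrite /tMN -(mulmxA (M a)) cliffordNM mulmxBr mulmxBl mul_mx_scalar -!scalemxAl.
by rewrite raddfB /= mxtraceZ trMN !mulmxA; congr (_ - _); ring.
Qed.

Let tMN_swap34 a b c d :
  tMN a b c d = 4%:R * opair c d * opair a b - tMN a b d c.
Proof.
rewrite /tMN -!mulmxA cliffordMN !mulmxBr mul_mx_scalar -!scalemxAr.
by rewrite raddfB /= mxtraceZ trMN; congr (_ - _); ring.
Qed.

(* The trace of sum_k N(e_k) Z M(w_k) is 4 tr Z by cyclicity, while moving     *)
(* M(w_k) to the left turns it into traces on the other half-spin space.       *)
Let tMN_contract a b c d :
  4%:R * tMN a b c d =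
  tNM d a b c - tNM c a b d + tNM b a c d + 3%:R * tNM a b c d.
Proof.
have <- : \tr (K1 (M a *m N b *m M c *m N d)) = 4%:R * tMN a b c d.
  set X := _ *m N d.
  transitivity (\tr ((\sum_k M (w k) *m N (e k)) *m X)); last first.
    by rewrite sum_MN mul_scalar_mx mxtraceZ.
  rewrite mulmx_suml !raddf_sum; apply: eq_bigr => k _ /=.
  by rewrite mxtrace_mulC mulmxA.
rewrite K1N K2M K1N -[M a]mul1mx K2M K1_1 mul1mx mulmx1 mul_scalar_mx.
rewrite !(mulmxBl, raddfB) /= -!scalemxAl mxtraceZ !mulmxA /tNM; ring.
Qed.

(** Anticommutation and cyclicity ([rot]) only give the sum of the traces on the two half-spin
    spaces. The contraction identity is a second relation between them, and together they determine
    both. *)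
Lemma tr_MNMN a b c d : \tr (M a *m N b *m M c *m N d) = 2%:R *
  (opair a b * opair c d - opair a c * opair b d + opair a d * opair b c).
Proof.
rewrite -/(tMN a b c d); apply: mul4_inj => /=.
have := tMN_contract a b c d.
rewrite (tNMC d) (tNM_swap12 c) (tNM_swap23 a c) (tNM_swap12 b a).
rewrite (opairC c a) (opairC c b) (opairC b a) => contr.
have rot : tMN a b c d = 4%:R * opair a b * opair c d
    - (4%:R * opair a c * opair b d - (4%:R * opair a d * opair b c - tNM a b c d)).
  by rewrite tMN_swap12 tMN_swap23 tMN_swap34 tNMC; ring.
by rewrite contr rot; ring.
Qed.

End Traces.

(** * The annihilator of an isotropic plane *)

Section DualProjector.
Variables (A : comNzRingType) (half : A).
Hypothesis half2 : half * 2%:R = 1.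
Local Notation N := (@gammaN A).
Local Notation M := (@gammaM A).
Local Notation J := (@hyperbolic A).
Variable P : 'M[A]_(4 + 4).
Local Notation p i := (row i P).
Local Notation w i := (row i J).

(* For P = u_1 p_1 + u_2 p_2 with p_i in V dual to u_i, this is               *)
(* u_1 u_2 p_2 p_1 - <p_1, p_2> u_1 u_2 / 2 in the Clifford algebra.           *)
Definition dual_projector : 'M[A]_(4 + 4) :=
  half *: \sum_i \sum_j M (w i) *m N (w j) *m M (p j) *m N (p i).
Local Notation E := dual_projector.

Hypotheses (PP : P *m P = P) (trP : \tr P = 2%:R).
Hypothesis isoP : P *m J *m P^T = 0.
Hypothesis rankP : forall (K : fieldType) (g : {rmorphism A -> K}),
  \rank (map_mx g P) = 2%N.

Let pp i j : opair (p i) (p j) = 0.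
Proof.
have /matrixP/(_ 0 0) := hyperbolicE (p i) (p j); rewrite [RHS]mxE mulr1n => <-.
transitivity ((P *m J *m P^T) i j); last by rewrite isoP mxE.
by rewrite -row_mul mxE [RHS]mxE; apply: eq_bigr => l _; rewrite !mxE.
Qed.

Let pw i j : opair (p i) (w j) = P i j.
Proof. by rewrite opair_row mxE. Qed.

Let wp i j : opair (w i) (p j) = P j i.
Proof. by rewrite opairC pw. Qed.

(** Twice the sum of the principal 2 x 2 minors, that is [(tr P)^2 - tr (P^2) = 4 - 2]. *)
Let sum_minors : \sum_i \sum_j (P j j * P i i - P j i * P i j) = 2%:R.
Proof.
have -> : \sum_i \sum_j (P j j * P i i - P j i * P i j) =
    \tr P * \tr P - \tr (P *m P).
  rewrite /mxtrace mulr_sumr -sumrB; apply: eq_bigr => i _.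
  rewrite mulr_suml mxE -sumrB; apply: eq_bigr => j _.
  by rewrite [P j i * _]mulrC.
by rewrite PP trP; ring.
Qed.

(** Anticommuting [p j] and [p i] to the front leaves a principal minor of [P] as scalar, and every
    other term starts with [M (p i)] or [M (p j)]. *)
Let quad i j : M (w i) *m N (w j) *m M (p j) *m N (p i) =
  (P j j * P i i - P j i * P i j)%:M -
  (M (p i) *m (P j j *: N (w i) - P j i *: N (w j))
   - M (p j) *m (N (w i) *m M (w j) *m N (p i))).
Proof.
rewrite -(mulmxA (M (w i))) cliffordNM wp mulmxBr mulmxBl mul_mx_scalar -scalemxAl.
rewrite (mulmxA (M (w i))) (cliffordMN (w i) (p j)) wp !mulmxBl mul_scalar_mx.
rewrite -scalemxAl !(cliffordMN _ (p i)) !wp !scalerBr !scale_scalar_mx.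
rewrite (raddfB (@scalar_mx A 8)) /= !mulmxBr -!scalemxAr !mulmxA.
rewrite ?opprB ?opprD ?opprK ?addrA.
by rewrite [LHS](ACl (1*5*3*4*2)).
Qed.

(** By [quad] and [sum_minors], [E] is 1 up to terms starting with some [M (p k)]. These vanish on
    every spinor killed by all [p k], so [E] fixes it. *)
Lemma dual_projector_compl :
  exists Z : 'I_(4 + 4) -> 'M[A]_(4 + 4), 1%:M - E = \sum_k M (p k) *m Z k.
Proof.
exists (fun k => half *: (\sum_j (P j j *: N (w k) - P j k *: N (w j))
                          - \sum_j N (w j) *m M (w k) *m N (p j))).
under eq_bigr => k _ do rewrite -scalemxAr mulmxBr !mulmx_sumr.
rewrite -scaler_sumr sumrB [X in _ = _ *: (_ - X)]exchange_big -sumrB /=.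
have -> : 1%:M = half *: \sum_i \sum_j (P j j * P i i - P j i * P i j)%:M :> 'M_(4 + 4).
  under eq_bigr => i _ do rewrite -raddf_sum.
  by rewrite -raddf_sum sum_minors scale_scalar_mx half2.
rewrite /E -scalerBr -sumrB; congr (_ *: _); apply: eq_bigr => i _.
by rewrite -!sumrB; apply: eq_bigr => j _; rewrite quad opprB addrC subrK.
Qed.

(** Locally the [p i] are combinations of two orthogonal vectors of norm 0, whose operators
    anticommute; in a product of three of them one is repeated and its square is 0. *)
Let triple i j k : M (p i) *m N (p j) *m M (p k) = 0.
Proof.
apply/matrixP => x y; rewrite [RHS]mxE; apply: local_eq0 => K g.
have [a [X [Y [ga aP _ YP]]]] := local_frame PP (rankP g).
exists (a ^+ 3); first by rewrite rmorphXn expf_neq0.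
pose q l := row l Y.
have qq l m : opair (q l) (q m) = 0.
  have /matrixP/(_ 0 0) := hyperbolicE (q l) (q m); rewrite [RHS]mxE mulr1n => <-.
  rewrite /q -YP !row_mul trmx_mul !mulmxA -(mulmxA _ P) -(mulmxA _ (P *m J)).
  by rewrite isoP mulmx0 mul0mx mxE.
have qn l : onorm (q l) = 0.
  have /matrixP/(_ 0 0) := gammaMN (q l); rewrite [RHS]mxE mulr1n => <-.
  apply: (mul2_inj half2); rewrite mulr0 mulr_natl mulr2n.
  have /matrixP/(_ 0 0) := anticommMN (q l) (q l).
  by rewrite qq raddf0 !mxE.
have qMN l m : M (q l) *m N (q m) = - (M (q m) *m N (q l)).
  by rewrite cliffordMN qq raddf0 sub0r.
have qMNM l m n : M (q l) *m N (q m) *m M (q n) = 0.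
  have [<-|lm] := eqVneq l m; first by rewrite gammaMN qn raddf0 mul0mx.
  have [<-|mn] := eqVneq m n.
    by rewrite -mulmxA gammaNM qn raddf0 mulmx0.
  (* Both outer indices differ from [m], and there are only two indices. *)
  have -> : n = l.
    by apply/val_inj; case: l m n lm mn => [[|[|?]] ?] [[|[|?]] ?] [[|[|?]] ?].
  by rewrite qMN mulNmx -mulmxA gammaNM qn raddf0 mulmx0 oppr0.
have ap l : a *: p l = \sum_m X l m *: q m.
  have -> : a *: p l = row l (a *: P) by rewrite linearZ.
  rewrite aP row_mul mulmx_sum_row.
  by apply: eq_bigr => m _; rewrite mxE.
suff /matrixP/(_ x y) : a ^+ 3 *: (M (p i) *m N (p j) *m M (p k)) = 0.
  by rewrite [LHS]mxE [RHS]mxE.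
have -> : a ^+ 3 *: (M (p i) *m N (p j) *m M (p k)) =
    M (a *: p i) *m N (a *: p j) *m M (a *: p k).
  rewrite !gammaMZ !gammaNZ -!scalemxAl -!scalemxAr -!scalemxAl !scalerA.
  by congr (_ *: _); ring.
have MS c : M (\sum_m c m *: q m) = \sum_m c m *: M (q m).
  by rewrite linear_sum /=; apply: eq_bigr => m _; rewrite gammaMZ.
have NS c : N (\sum_m c m *: q m) = \sum_m c m *: N (q m).
  by rewrite linear_sum /=; apply: eq_bigr => m _; rewrite gammaNZ.
rewrite !ap !MS NS !mulmx_suml big1 // => l _.
rewrite -mulmxA mulmx_suml mulmx_sumr big1 // => m _.
rewrite !mulmx_sumr big1 // => n _.
by rewrite -!(scalemxAl, scalemxAr) mulmxA qMNM !scaler0.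
Qed.

Lemma dual_projector_gammaM k : E *m M (p k) = 0.
Proof.
rewrite /E -scalemxAl mulmx_suml big1 ?scaler0 // => i _.
rewrite mulmx_suml big1 // => j _.
by rewrite -!mulmxA (mulmxA (M (p j))) triple !mulmx0.
Qed.

Lemma dual_projectorP (x : 'rV_(4 + 4)) : x *m E = x <-> forall k, x *m M (p k) = 0.
Proof.
split=> [<- k|x0]; first by rewrite -mulmxA dual_projector_gammaM mulmx0.
have [Z EZ] := dual_projector_compl; apply/esym/eqP.
rewrite -subr_eq0 -[X in X - _]mulmx1 -mulmxBr EZ mulmx_sumr big1 // => k _.
by rewrite mulmxA x0 mul0mx.
Qed.

Lemma dual_projector_idem : E *m E = E.
Proof.
apply: eq_mulmx => x; rewrite mulmxA; apply/dual_projectorP => k.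
by rewrite -mulmxA dual_projector_gammaM mulmx0.
Qed.

(** As the [p i] are mutually orthogonal, [tr_MNMN] gives twice a principal minor for each term. *)
Lemma tr_dual_projector : \tr E = 2%:R.
Proof.
rewrite /E mxtraceZ raddf_sum /=.
rewrite (eq_bigr (fun i => 2%:R * \sum_j (P j j * P i i - P j i * P i j))).
  by rewrite -mulr_sumr sum_minors mulrA half2 mul1r.
move=> i _; rewrite raddf_sum mulr_sumr; apply: eq_bigr => j _ /=.
by rewrite (tr_MNMN half2) !wp pp; congr (_ * _); ring.
Qed.

(** The dual form of [dual_projector_compl]: adjunction for the pairing [J] turns [M (p k)] into
    [N (p k)]. *)
Lemma dual_projector_orth (s : 'rV_(4 + 4)) :
  s *m J *m E^T = 0 ->
  exists y : 'I_(4 + 4) -> 'rV[A]_(4 + 4), s = \sum_k y k *m N (p k).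
Proof.
move=> sE; have [Z EZ] := dual_projector_compl.
exists (fun k => s *m J *m (Z k)^T *m J).
have sEJ : s = s *m J *m (1%:M - E)^T *m J.
  rewrite [X in _ *m X *m _]raddfB /= mulmxBr sE subr0 trmx1 mulmx1.
  by rewrite -mulmxA hyperbolicK mulmx1.
rewrite {1}sEJ EZ raddf_sum mulmx_sumr mulmx_suml; apply: eq_bigr => k _ /=.
have MJ : (M (p k))^T *m J = J *m N (p k).
  have : J *m (N (p k) *m J) *m J = J *m (J *m (M (p k))^T) *m J by rewrite gamma_adj.
  by rewrite -!mulmxA hyperbolicK mulmx1 !mulmxA hyperbolicK mul1mx => ->.
by rewrite trmx_mul !mulmxA -(mulmxA _ _^T J) MJ !mulmxA.
Qed.

(** By [omulK], [onorm x] kills every row of [P], hence also the trace 2 of [P], which is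
    invertible. *)
Lemma dual_projector_iso (x : 'rV_(4 + 4)) : (forall k, x *m M (p k) = 0) -> onorm x = 0.
Proof.
move=> x0; have xp k : onorm x *: p k = 0.
  have := omulK (oconj x) (p k); rewrite oconjK onorm_conj => <-.
  have -> : omul (oconj x) (p k) = oconj (x *m M (p k)).
    by rewrite mul_gammaM oconjM oconjK.
  by rewrite x0 !linear0.
apply: (mul2_inj half2); rewrite mulr0 mulrC -trP mulr_sumr big1 // => k _.
by have /matrixP/(_ 0 k) := xp k; rewrite !mxE.
Qed.

End DualProjector.

(** * Octonion coordinates on the half-spin representations *)

Section SpinorCoordinates.
Variable A : comNzRingType.
Implicit Types (v : 'rV[A]_(4 + 4)) (x y : exterior A) (l : bitseq).

(** With bit lists, membership, parity and Koszul signs are settled by evaluation. *)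
Definition subset_of_bits l : {set 'I_4} := [set i : 'I_4 | nth false l i].
Local Notation S := subset_of_bits.

Lemma bits_setD1 l i : S l :\ i = S (set_nth false l i false).
Proof.
apply/setP => j; rewrite !inE nth_set_nth /= -val_eqE /=.
by case: eqP.
Qed.

Lemma bits_setU1 l i : i |: S l = S (set_nth false l i true).
Proof.
apply/setP => j; rewrite !inE nth_set_nth /= -val_eqE /=.
by case: eqP.
Qed.

Lemma bits_subset (I : {set 'I_4}) : exists a b c d, I = S [:: a; b; c; d].
Proof.
pose m k := inord k \in I; exists (m 0%N), (m 1%N), (m 2%N), (m 3%N).
apply/setP => i; rewrite inE -[i in LHS]inord_val.
by case: i => [[|[|[|[|?]]]] ?].
Qed.

Lemma card_bits a b c d : #|S [:: a; b; c; d]| = (a + b + c + d)%N.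
Proof.
rewrite -sum1_card big_mkcond !big_ord_recl big_ord0 !inE /=.
by case: a b c d => [] [] [] [].
Qed.

Lemma koszul_sign_bits a b c d (i : 'I_4) : let l := [:: a; b; c; d] in
  koszul_sign i (S l) = (-1) ^+ count id (take i l) :> A.
Proof.
move=> l; congr (_ ^+ _).
rewrite -sum1_card big_mkcond !big_ord_recl big_ord0 !inE /=.
by case: i => [[|[|[|[|?]]]] ?] //=; case: a b c d {l} => [] [] [] [].
Qed.

Lemma clifford_bits v x a b c d : let l := [:: a; b; c; d] in
  clifford v x (S l) = \sum_(i < 4)
    (entry v i * (if nth false l i
       then (-1) ^+ count id (take i l) * x (S (set_nth false l i false)) else 0)
   + entry v (4 + i) * (if nth false l i
       then 0 else (-1) ^+ count id (take i l) * x (S (set_nth false l i true)))).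
Proof.
move=> l; rewrite ffunE; apply: eq_bigr => i _.
rewrite !ffunE inE koszul_sign_bits bits_setD1 bits_setU1 /entry.
by congr (v 0 _ * _ + v 0 _ * _); apply/val_inj; rewrite /= inordK //;
   case: i => [[|[|[|[|?]]]] ?].
Qed.

Local Notation t := true.
Local Notation f := false.

(* Up to sign and order, the basis c(v) y_0 of Delta_+, where                *)
(* y_0 = e_0 + e_1 /\ e_2 /\ e_3 and v runs through the basis of V.          *)
Definition plus_row x : 'rV[A]_(4 + 4) := row8
  [:: x (S [:: t; t; t; t]);
      - x (S [:: t; t; f; f]);
      - x (S [:: t; f; t; f]);
      - x (S [:: t; f; f; t]);
      x (S [:: f; f; f; f]);
      x (S [:: f; f; t; t]);
      - x (S [:: f; t; f; t]);
      x (S [:: f; t; t; f])].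

(* The corresponding basis c(1) c(v) y_0 of Delta_-, where 1 = e_0 + f_0 is   *)
(* the unit of the octonion product v . v' defined by c(v) c(1) c(v') y_0 =   *)
(* c(v . v') y_0.                                                             *)
Definition minus_row x : 'rV[A]_(4 + 4) := row8
  [:: x (S [:: f; t; t; t]);
      - x (S [:: f; t; f; f]);
      - x (S [:: f; f; t; f]);
      - x (S [:: f; f; f; t]);
      x (S [:: t; f; f; f]);
      x (S [:: t; f; t; t]);
      - x (S [:: t; t; f; t]);
      x (S [:: t; t; t; f])].

(** The order and signs in [plus_row] and [minus_row] are chosen to make the Clifford action a left
    multiplication of octonions. *)
Lemma plus_row_clifford v y : plus_row (clifford v y) = omul v (minus_row y).
Proof.
apply: eq_entries; do 8?[case=> [_|]; last first] => //.
all: rewrite !entry_row8 //= clifford_bits /= !big_ord_recl big_ord0 /=.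
all: rewrite (_ : bump 0 0 = 1)%N // (_ : bump 0 1 = 2)%N // (_ : bump 0 2 = 3)%N //.
all: rewrite (_ : 4 + 0 = 4)%N // (_ : 4 + 1 = 5)%N // (_ : 4 + 2 = 6)%N //.
all: rewrite (_ : 4 + 3 = 7)%N //; ring.
Qed.

Lemma odd_bits a b c d : odd #|S [:: a; b; c; d]| = a (+) b (+) c (+) d.
Proof. by rewrite card_bits; case: a b c d => [] [] [] []. Qed.

Lemma eq_plus_row x x' : Delta_plus x -> Delta_plus x' ->
  plus_row x = plus_row x' -> x = x'.
Proof.
move=> ex ex' e; apply/ffunP => I; have [a [b [c [d ->]]]] := bits_subset I.
have [o|] := boolP (odd #|S [:: a; b; c; d]|); first by rewrite ex // ex'.
have ek k : entry (plus_row x) k = entry (plus_row x') k by rewrite e.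
move: (ek 0)%N (ek 1)%N (ek 2)%N (ek 3)%N (ek 4)%N (ek 5)%N (ek 6)%N (ek 7)%N.
rewrite !entry_row8 //= odd_bits => e0 /oppr_inj e1 /oppr_inj e2 /oppr_inj e3 e4 e5.
by move=> /oppr_inj e6 e7; case: a b c d => [] [] [] [].
Qed.

Lemma Delta_plus_clifford v y : Delta_minus y -> Delta_plus (clifford v y).
Proof.
move=> oy I; have [a [b [c [d ->]]]] := bits_subset I => o.
rewrite clifford_bits big1 // => i _; move: o; rewrite odd_bits => o.
case: ifP => bi; rewrite oy ?(mulr0, addr0) //.
all: case: i bi => [[|[|[|[|?]]]] ?] //=; rewrite odd_bits; move: o.
all: by case: a b c d => [] [] [] [].
Qed.

Lemma minus_row_surj (r : 'rV[A]_(4 + 4)) : exists2 y, Delta_minus y & minus_row y = r.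
Proof.
pose e := entry r.
pose g a b c d := match a, b, c, d with
  | f, t, t, t => e 0%N | f, t, f, f => - e 1%N | f, f, t, f => - e 2%N
  | f, f, f, t => - e 3%N | t, f, f, f => e 4%N | t, f, t, t => e 5%N
  | t, t, f, t => - e 6%N | t, t, t, f => e 7%N | _, _, _, _ => 0 end.
pose m (I : {set 'I_4}) k := inord k \in I.
pose y : exterior A := [ffun I => g (m I 0) (m I 1) (m I 2) (m I 3)]%N.
have yE a b c d : y (S [:: a; b; c; d]) = g a b c d.
  by rewrite ffunE /m !inE !inordK.
exists y.
  move=> I; have [a [b [c [d ->]]]] := bits_subset I; rewrite odd_bits yE.
  by case: a b c d => [] [] [] [].
by apply: eq_entries; do 8?[case=> [_|]] => //; rewrite entry_row8 //= yE ?opprK.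
Qed.

Lemma plus_rowD : {morph plus_row : x y / x + y}.
Proof.
move=> x y; apply: eq_entries; do 8?[case=> [_|]] => //.
all: by rewrite entryD !entry_row8 //= ffunE ?opprD.
Qed.

Lemma plus_row_sum r (x : 'I_r -> exterior A) :
  plus_row (\sum_i x i) = \sum_i plus_row (x i).
Proof.
apply: (big_morph _ plus_rowD); apply: eq_entries; do 8?[case=> [_|]] => //.
all: by rewrite entry_row8 //= ffunE ?oppr0 /entry mxE.
Qed.

End SpinorCoordinates.

(** * Duality between OG(2, V) and OG(2, Delta_+) *)

Section BaseChange.
Variables (A B : comNzRingType) (f : {rmorphism A -> B}).

Lemma map_gammaN v : map_mx f (gammaN v) = gammaN (map_mx f v).
Proof.
have fe w k : entry (map_mx f w) k = f (entry w k) by rewrite /entry mxE.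
apply/row_matrixP => i; rewrite -map_row !rowE mul_gammaN -(map_delta_mx f).
rewrite mul_gammaN; apply: eq_entries; do 8?[case=> [_|]] => //.
all: by rewrite fe !entry_row8 //= !fe ?(rmorphD, rmorphN, rmorphM).
Qed.

Lemma map_oconj v : map_mx f (oconj v) = oconj (map_mx f v).
Proof.
have fe w k : entry (map_mx f w) k = f (entry w k) by rewrite /entry mxE.
apply: eq_entries; do 8?[case=> [_|]] => //.
all: by rewrite fe !entry_row8 //= fe ?rmorphN.
Qed.

Lemma map_gammaM v : map_mx f (gammaM v) = gammaM (map_mx f v).
Proof. by rewrite [LHS](map_gammaN (oconj v)) map_oconj. Qed.

Lemma map_hyperbolic : map_mx f (hyperbolic A) = hyperbolic B.
Proof. by rewrite map_block_mx !map_mx0 !map_mx1. Qed.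

Lemma map_dual_projector half P :
  map_mx f (dual_projector half P) = dual_projector (f half) (map_mx f P).
Proof.
rewrite map_mxZ /=; congr (_ *: _); rewrite raddf_sum; apply: eq_bigr => i _ /=.
rewrite raddf_sum; apply: eq_bigr => j _ /=.
by rewrite !map_mxM /= !map_gammaM !map_gammaN !map_row map_hyperbolic.
Qed.

End BaseChange.

(** Since [V] and [Delta_+] share the octonion coordinates, this one definition serves in both
    directions. *)
Definition annihilator (A : comNzRingType) (U : set 'rV[A]_(4 + 4)) :
    set 'rV[A]_(4 + 4) :=
  [set x | forall u, U u -> x *m gammaM u = 0].

Lemma annihilator_sym (A : comNzRingType) (x u : 'rV[A]_(4 + 4)) :
  x *m gammaM u = 0 -> u *m gammaM x = 0.
Proof.
rewrite !mul_gammaM => e; have -> : omul (oconj x) u = oconj (omul (oconj u) x).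
  by rewrite oconjM oconjK.
by rewrite e linear0.
Qed.

Lemma annihilator_rowspace (A : comNzRingType) (P : 'M[A]_(4 + 4)) x :
  annihilator (rowspace P) x <-> forall k, x *m gammaM (row k P) = 0.
Proof.
split=> [Ux k|xP _ [u _ <-]]; first by apply: Ux; exists (delta_mx 0 k); rewrite ?rowE.
apply: annihilator_sym; rewrite -mulmxA (_ : P *m gammaM x = 0) ?mulmx0 //.
by apply/row_matrixP => k; rewrite row_mul row0; exact: annihilator_sym.
Qed.

Lemma delta_mx_form (A : pzSemiRingType) n (Z : 'M[A]_n) i j :
  ((delta_mx 0 i : 'rV_n) *m Z *m (delta_mx 0 j : 'rV_n)^T) 0 0 = Z i j.
Proof. by rewrite trmx_delta -rowE -colE !mxE. Qed.

Section OrthogonalGrassmannian.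
Variable R : realType.
Local Notation C := R[i].

(** As 2 is invertible and [Q] is symmetric, polarization turns the vanishing of the quadratic form
    on [U] into a matrix equation on [P]. *)
Lemma OG_pointsP k n (Q : 'M[C]_n) (A : comAlgType C) (U : set 'rV[A]_n) :
  Q^T = Q -> OG_points k Q U <-> exists P : 'M[A]_n,
    [/\ projector k P, P *m map_mx (in_alg A) Q *m P^T = 0 & U = rowspace P].
Proof.
move=> QT; set QA := map_mx _ Q; split=> [[/summandP[P pP UE] iU]|[P [pP PQ UE]]].
  exists P; split=> //; rewrite -/QA in iU.
  have iP (u : 'rV_n) : u *m (P *m QA *m P^T) *m u^T = 0.
    have := iU (u *m P); rewrite trmx_mul !mulmxA; apply.
    by rewrite UE; exists u.
  have : (P *m QA *m P^T)^T = P *m QA *m P^T.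
    by rewrite !trmx_mul trmxK map_trmx QT mulmxA.
  move: iP; move: (P *m QA *m P^T) => Z iP ZT; apply/matrixP => i j; rewrite [RHS]mxE.
  have := iP (delta_mx 0 i + delta_mx 0 j : 'rV_n).
  rewrite linearD /= !mulmxDl !mulmxDr !iP add0r addr0.
  move=> /matrixP/(_ 0 0); rewrite mxE !delta_mx_form [RHS]mxE.
  rewrite -{2}ZT mxE -mulr2n -scaler_nat => /(congr1 (GRing.scale (2%:R : C)^-1)).
  by rewrite scalerA mulVf ?Num.Theory.pnatr_eq0 // scale1r scaler0.
split; first by apply/summandP; exists P.
move=> u; rewrite UE => -[x _ <-].
transitivity (x *m (P *m QA *m P^T) *m x^T); first by rewrite trmx_mul !mulmxA.
by rewrite PQ mulmx0 mul0mx.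
Qed.

(** Taken as the image of a constant of [C], so that algebra morphisms preserve it. *)
Definition alg_half (A : comAlgType C) : A := in_alg A (2%:R)^-1.

Lemma alg_half2 (A : comAlgType C) : alg_half A * 2%:R = 1.
Proof.
rewrite -(rmorph_nat (in_alg A)) -rmorphM mulVf ?rmorph1 //.
by rewrite Num.Theory.pnatr_eq0.
Qed.

Lemma VQ_sym : (VQ : 'M[C]_(4 + 4))^T = VQ.
Proof. exact: tr_hyperbolic. Qed.

Lemma map_VQ (A : comAlgType C) : map_mx (in_alg A) VQ = hyperbolic A.
Proof. by rewrite map_block_mx !map_mx0 !map_mx1. Qed.

Lemma OG8_pointsP (A : comAlgType C) (U : set 'rV[A]_(4 + 4)) :
  OG_points 2 VQ U <-> exists P : 'M[A]_(4 + 4),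
    [/\ projector 2 P, P *m hyperbolic A *m P^T = 0 & U = rowspace P].
Proof. by rewrite (OG_pointsP _ _ VQ_sym) map_VQ. Qed.

Section Annihilator.
Variables (A : comAlgType C) (P : 'M[A]_(4 + 4)).
Hypotheses (pP : projector 2 P) (isoP : P *m hyperbolic A *m P^T = 0).

Let rankP (K : fieldType) (g : {rmorphism A -> K}) : \rank (map_mx g P) = 2%N.
Proof. exact: projector_rank pP. Qed.

Local Notation E := (dual_projector (alg_half A) P).

Lemma projector_dual : projector 2 E.
Proof.
by split; [exact: (dual_projector_idem (alg_half2 A) pP.1 pP.2 isoP rankP)
          |exact: (tr_dual_projector (alg_half2 A) pP.1 pP.2 isoP)].
Qed.

Lemma annihilatorE : annihilator (rowspace P) = rowspace E.
Proof.
have EP := dual_projectorP (alg_half2 A) pP.1 pP.2 isoP rankP.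
apply/seteqP; split=> x.
  by move=> /annihilator_rowspace/EP xE; exists x.
by move=> /(rowspaceP _ projector_dual.1)/EP xP; exact/annihilator_rowspace.
Qed.

Lemma annihilator_OG : OG_points 2 VQ (annihilator (rowspace P)).
Proof.
split; first by apply/summandP; exists E; [exact: projector_dual|exact: annihilatorE].
move=> x /annihilator_rowspace xP; rewrite map_VQ hyperbolicE opair_diag.
by rewrite (dual_projector_iso (alg_half2 A) pP.2 xP) mulr0 raddf0.
Qed.

End Annihilator.

(** [U] lies in its double annihilator by [annihilator_sym]; as both are summands of rank 2, they
    agree. *)
Lemma annihilatorK (A : comAlgType C) (U : set 'rV[A]_(4 + 4)) :
  OG_points 2 VQ U -> annihilator (annihilator U) = U.
Proof.
move=> OGU; have /OG8_pointsP[P [pP isoP UE]] := OGU; rewrite UE.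
have /OG8_pointsP[E [pE isoE EE]] := annihilator_OG pP isoP; rewrite EE.
rewrite (annihilatorE pE isoE); apply/esym/(projector_eq pP (projector_dual pE isoE)).
rewrite -(annihilatorE pE isoE) -EE => u Pu x Px; apply/annihilator_sym.
exact: Px.
Qed.

Lemma annihilator_base_change (A B : comAlgType C) (f : {lrmorphism A -> B})
    (U : set 'rV[A]_(4 + 4)) : OG_points 2 VQ U ->
  annihilator (base_change f U) = base_change f (annihilator U).
Proof.
move=> /OG8_pointsP[P [pP isoP ->]].
have fiso : map_mx f P *m hyperbolic B *m (map_mx f P)^T = 0.
  by rewrite -(map_hyperbolic f) map_trmx -!map_mxM isoP map_mx0.
rewrite rowspace_base_change (annihilatorE (projector_map f pP) fiso).
rewrite (annihilatorE pP isoP) rowspace_base_change map_dual_projector.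
by rewrite /alg_half /= rmorph_alg.
Qed.

(** One direction is the adjunction [opair_omul]. Conversely, [dual_projector_orth] writes a spinor
    orthogonal to the annihilator as a sum of Clifford images under the eight rows of [P]. *)
Lemma spinor_relationsP (A : comAlgType C) (U : set 'rV[A]_(4 + 4)) (x : exterior A) :
  OG_points 2 VQ U -> Delta_plus x ->
  spinor_relations U x <-> forall z, annihilator U z -> opair (plus_row x) z = 0.
Proof.
move=> OGU ex; split=> [[r [u [y [Uu oy ->]]]] z Uz|xz].
  rewrite plus_row_sum opairC linear_sum /= big1 // => i _.
  rewrite plus_row_clifford opairC opair_omul -mul_gammaM Uz //; exact: linear0.
have /OG8_pointsP[P [pP isoP UE]] := OGU.
have /(dual_projector_orth (alg_half2 A) pP.1 pP.2)[y yE] :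
    plus_row x *m hyperbolic A *m (dual_projector (alg_half A) P)^T = 0.
  apply/rowP => k; rewrite [RHS]mxE.
  have := xz (row k (dual_projector (alg_half A) P)).
  rewrite {1}UE (annihilatorE pP isoP) => xk.
  have /matrixP/(_ 0 0) :=
    hyperbolicE (plus_row x) (row k (dual_projector (alg_half A) P)).
  rewrite xk ?raddf0; last by exists (delta_mx 0 k); rewrite ?rowE.
  by rewrite [RHS]mxE tr_row => <-; rewrite !mxE; apply: eq_bigr => l _; rewrite !mxE.
have [z zP] := choice (fun k => let: ex_intro2 z oz ez := minus_row_surj (y k) in
  ex_intro (fun z => Delta_minus z /\ minus_row z = y k) z (conj oz ez)).
exists 8%N, (fun k => row k P), z; split.
- by move=> k; rewrite UE; exists (delta_mx 0 k); rewrite ?rowE.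
- by move=> k; case: (zP k).
apply: eq_plus_row => //.
  move=> I oI; rewrite sum_ffunE big1 // => k _.
  by apply: Delta_plus_clifford; case: (zP k).
rewrite plus_row_sum yE; apply: eq_bigr => k _.
by rewrite plus_row_clifford (zP k).2 mul_gammaN.
Qed.

End OrthogonalGrassmannian.

(** * Symmetric bilinear forms over an algebraically closed field *)

(** Otherwise polarization gives [S = 0], which is not invertible in positive size. *)
Lemma nonisotropic_row (F : numFieldType) n (S : 'M[F]_(1 + n)) :
  S^T = S -> S \in unitmx -> exists t : 'rV_(1 + n), (t *m S *m t^T) 0 0 != 0.
Proof.
move=> ST uS; apply: contrapT => /forallNP iso.
have {}iso (x : 'rV_(1 + n)) : (x *m S *m x^T) 0 0 = 0.
  by apply/eqP; apply: contraT => /iso.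
suff S0 : S = 0.
  by move: uS; rewrite S0 unitmxE det0 ?unitr0 // expr0n.
apply/matrixP => i j; rewrite [RHS]mxE.
have := iso (delta_mx 0 i + delta_mx 0 j).
rewrite linearD /= !mulmxDl !mulmxDr mxE [X in X + _]mxE [X in _ + X]mxE.
rewrite !iso add0r addr0 !delta_mx_form -{2}ST mxE -mulr2n.
by move=> /eqP; rewrite Num.Theory.mulrn_eq0 => /eqP.
Qed.

Lemma orthogonal_hyperplane (F : fieldType) n (S : 'M[F]_(1 + n)) (t : 'rV_(1 + n)) :
    S^T = S -> S \in unitmx -> (t *m S *m t^T) 0 0 != 0 ->
  exists K : 'M_(n, 1 + n), K *m S *m t^T = 0 /\ K *m S *m K^T \in unitmx.
Proof.
move=> ST uS; set c := t *m S *m t^T => c0.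
have [K [fK Kt]] : exists K : 'M_(n, 1 + n), row_free K /\ K *m (S *m t^T) = 0.
  have : exists K : 'M_(\rank (kermx (S *m t^T)), 1 + n),
      row_free K /\ K *m (S *m t^T) = 0.
    exists (row_base (kermx (S *m t^T))); split; first exact: row_base_free.
    by apply/sub_kermxP; rewrite eq_row_base.
  rewrite mxrank_ker (_ : \rank _ = 1%N) ?addKn //.
  apply/eqP; rewrite eqn_leq rank_leq_col lt0n mxrank_eq0.
  by apply: contra c0 => /eqP e; rewrite /c -mulmxA e mulmx0 mxE.
rewrite mulmxA in Kt; exists K; split=> //.
(* As [t] is not isotropic, it is independent of its orthogonal. In the basis [t], [K] the form is
   block diagonal, so its block on [K] is invertible. *)
have uM : col_mx t K \in unitmx.
  rewrite -row_free_unit; apply/inj_row_free => v.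
  rewrite -[v]hsubmxK; set a := lsubmx v; set b := rsubmx v => e.
  rewrite mul_row_col in e.
  have a0 : a = 0.
    have := congr1 (fun x => x *m S *m t^T) e.
    rewrite !mul0mx !mulmxDl -!mulmxA (mulmxA K) Kt mulmx0 addr0.
    rewrite (mulmxA t) -/c [c]mx11_scalar mul_mx_scalar => /eqP.
    by rewrite scaler_eq0 (negPf c0) => /eqP.
  move: e; rewrite a0 mul0mx add0r => /eqP; rewrite mulmx_free_eq0 // => /eqP ->.
  by rewrite row_mx0.
have : col_mx t K *m S *m (col_mx t K)^T \in unitmx.
  by rewrite !unitmx_mul uM uS unitmx_tr uM.
rewrite tr_col_mx mul_col_mx mul_col_row Kt.
have -> : t *m S *m K^T = 0.
  by apply: trmx_inj; rewrite !trmx_mul trmxK ST mulmxA Kt trmx0.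
by rewrite unitmxE det_lblock unitrM => /andP[].
Qed.

(** Gram-Schmidt: a nonisotropic vector is divided by a square root of its value, and the induction
    continues on its orthogonal. *)
Lemma congruent_to_1 (F : numClosedFieldType) n (S : 'M[F]_n) :
  S^T = S -> S \in unitmx -> exists N : 'M_n, N *m S *m N^T = 1%:M.
Proof.
elim: n S => [|n IH].
  by move=> S _ _; exists 1%:M; rewrite [LHS]flatmx0 [RHS]flatmx0.
rewrite -add1n => S ST uS.
have [t t0] := @nonisotropic_row F n S ST uS.
have [K [Kt uK]] := @orthogonal_hyperplane F n S t ST uS t0.
have [|N NK] := IH _ _ uK; first by rewrite !trmx_mul trmxK ST mulmxA.
set c := t *m S *m t^T in t0.
pose d := Num.Theory.sqrtC (c 0 0).
exists (col_mx (d^-1 *: t) (N *m K) : 'M_(1 + n)).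
rewrite (tr_col_mx (d^-1 *: t)) (mul_col_mx (d^-1 *: t)) mul_col_row.
rewrite trmx_mul linearZ /=.
have -> : N *m K *m S *m (d^-1 *: t^T) = 0.
  by rewrite -scalemxAr -!mulmxA (mulmxA K) Kt mulmx0 scaler0.
have -> : d^-1 *: t *m S *m (K^T *m N^T) = 0.
  rewrite -!scalemxAl mulmxA (_ : t *m S *m K^T = 0) ?mul0mx ?scaler0 //.
  by apply: trmx_inj; rewrite !trmx_mul trmxK ST mulmxA Kt trmx0.
have -> : N *m K *m S *m (K^T *m N^T) = 1%:M by rewrite -NK !mulmxA.
have -> : d^-1 *: t *m S *m (d^-1 *: t^T) = 1%:M.
  rewrite -!scalemxAl -scalemxAr scalerA -/c [c]mx11_scalar scale_scalar_mx.
  rewrite -[c 0 0]Num.Theory.sqrtCK -/d -expr2 exprVn mulVf //.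
  by rewrite expf_neq0 // Num.Theory.sqrtC_eq0.
by rewrite -scalar_mx_block.
Qed.

(** Both [Q] and the form on the orthogonal of [t] are congruent to the identity, hence to each
    other. *)
Lemma hyperplane_isometry (F : numClosedFieldType) n (S : 'M[F]_(1 + n)) (Q : 'M_n)
    (t : 'rV_(1 + n)) :
    S^T = S -> S \in unitmx -> Q^T = Q -> Q \in unitmx ->
    (t *m S *m t^T) 0 0 != 0 ->
  exists B : 'M_(n, 1 + n), B *m S *m B^T = Q /\ B *m S *m t^T = 0.
Proof.
move=> ST uS QT uQ /(orthogonal_hyperplane ST uS)[K [Kt uK]].
have [|N NK] := congruent_to_1 _ uK; first by rewrite !trmx_mul trmxK ST mulmxA.
have [N' NQ] := congruent_to_1 QT uQ.
have uN' : N' \in unitmx by move: NQ; rewrite -mulmxA => /mulmx1_unit[].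
exists (invmx N' *m N *m K); split; last first.
  by rewrite -!mulmxA (mulmxA K) Kt !mulmx0.
transitivity (invmx N' *m (N *m (K *m S *m K^T) *m N^T) *m (invmx N')^T).
  by rewrite !trmx_mul !mulmxA.
by rewrite NK -NQ !mulmxA mulVmx // mul1mx -mulmxA -trmx_mul mulVmx // trmx1 mulmx1.
Qed.

(** [B' *m B] is the orthogonal projection along [t]: an explicit inverse of [col_mx t B] is checked
    on one side and used on the other. *)
Lemma hyperplane_coordinates (F : fieldType) n (S : 'M[F]_(1 + n)) (Q : 'M_n)
    (t : 'rV_(1 + n)) (B : 'M_(n, 1 + n)) :
    S^T = S -> Q \in unitmx -> (t *m S *m t^T) 0 0 != 0 ->
    B *m S *m B^T = Q -> B *m S *m t^T = 0 ->
  exists B' : 'M_(1 + n, n), B *m B' = 1%:M /\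
    exists z : 'rV_(1 + n), B' *m B = 1%:M - S *m t^T *m z.
Proof.
move=> ST uQ; set c := t *m S *m t^T => c0 BQ Bt.
exists (S *m B^T *m invmx Q).
have BB' : B *m (S *m B^T *m invmx Q) = 1%:M by rewrite !mulmxA BQ mulmxV.
split=> //; exists ((c 0 0)^-1 *: t).
suff : row_mx ((c 0 0)^-1 *: (S *m t^T)) (S *m B^T *m invmx Q) *m col_mx t B = 1%:M.
  rewrite mul_row_col => <-.
  by rewrite -!scalemxAr -!scalemxAl addrAC subrr add0r.
apply: mulmx1C; rewrite mul_col_row BB' -!scalemxAr !mulmxA Bt scaler0 -/c.
have -> : t *m S *m B^T = 0.
  by apply: trmx_inj; rewrite !trmx_mul trmxK ST mulmxA Bt trmx0.
rewrite mul0mx [c in _ *: c]mx11_scalar scale_scalar_mx mulVf //.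
by rewrite -scalar_mx_block.
Qed.

(** * The zero locus *)

Section ZeroLocus.
Variable R : realType.
Local Notation C := R[i].

Lemma VQ_unit : (VQ : 'M[C]_(4 + 4)) \in unitmx.
Proof. by have /mulmx1_unit[] := hyperbolicK C. Qed.

Lemma spinor_hyperplane (Q : 'M[C]_7) (t : 'rV[C]_(4 + 4)) :
    Q^T = Q -> Q \in unitmx -> onorm t != 0 ->
  exists (B : 'M[C]_(7, 4 + 4)) (B' : 'M[C]_(4 + 4, 7)) (z : 'rV[C]_(4 + 4)),
    [/\ B *m VQ *m B^T = Q, B *m VQ *m t^T = 0, B *m B' = 1%:M
      & B' *m B = 1%:M - VQ *m t^T *m z].
Proof.
move=> QT uQ t0.
have tt0 : (t *m VQ *m t^T) 0 0 != 0.
  rewrite (hyperbolicE t t) opair_diag mxE mulr1n mulf_neq0 //.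
  by rewrite Num.Theory.pnatr_eq0.
have [B [BQ Bt]] := @hyperplane_isometry C 7 VQ Q t (VQ_sym R) VQ_unit QT uQ tt0.
have [B' [BB' [z B'B]]] := @hyperplane_coordinates C 7 VQ Q t B (VQ_sym R) uQ tt0 BQ Bt.
by exists B, B', z.
Qed.

Lemma plus_row_constant (s : exterior C) (A : comAlgType C) :
  plus_row (constant_spinor s A) = map_mx (in_alg A) (plus_row s).
Proof.
apply: eq_entries; do 8?[case=> [_|]] => //.
all: rewrite /entry [RHS]mxE -!/(entry _ _) !entry_row8 //= !ffunE.
all: by rewrite -?[LHS]/(in_alg A _) ?scaleNr.
Qed.

Lemma zero_locus_pointsP (s : exterior C) (A : comAlgType C)
    (U : set 'rV[A]_(4 + 4)) : Delta_plus s ->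
  zero_locus_points s U <-> OG_points 2 VQ U /\ forall x, annihilator U x ->
    x *m hyperbolic A *m (map_mx (in_alg A) (plus_row s))^T = 0.
Proof.
move=> es; have es' : Delta_plus (constant_spinor s A).
  by move=> I oI; rewrite ffunE es // scale0r.
split=> -[OGU H]; split=> //.
  move=> x Ux; move/(spinor_relationsP OGU es'): H; rewrite plus_row_constant => H.
  by rewrite hyperbolicE opairC H // raddf0.
apply/(spinor_relationsP OGU es') => x Ux; rewrite plus_row_constant.
have /matrixP/(_ 0 0) := H x Ux.
by rewrite hyperbolicE opairC !mxE eqxx mulr1n.
Qed.

(** * Isotropic planes in the hyperplane orthogonal to [t] *)

Section Slice.
Variables (A : comAlgType C) (Q : 'M[A]_7) (t z : 'rV[A]_(4 + 4)).
Variables (B : 'M[A]_(7, 4 + 4)) (B' : 'M[A]_(4 + 4, 7)).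
Local Notation J := (hyperbolic A).
Hypotheses (BQ : B *m J *m B^T = Q) (Bt : B *m J *m t^T = 0).
Hypotheses (BB' : B *m B' = 1%:M) (B'B : B' *m B = 1%:M - J *m t^T *m z).

(** The map [y |-> y *m B] identifies [A^7] with the orthogonal of [t]; this is the trace of [L] on
    it. *)
Definition slice (L : set 'rV[A]_(4 + 4)) : set 'rV[A]_7 := [set y | L (y *m B)].

Section Restrict.
Variable E : 'M[A]_(4 + 4).
Hypotheses (pE : projector 2 E) (isoE : E *m J *m E^T = 0).
Hypothesis (Et : E *m J *m t^T = 0).

(** The rows of [E] are orthogonal to [t], hence fixed by the projection [B' *m B]. *)
Let EB : E *m B' *m B = E.
Proof. by rewrite -mulmxA B'B mulmxBr mulmx1 !mulmxA Et mul0mx subr0. Qed.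

Lemma slice_rowspace : slice (rowspace E) = rowspace (B *m E *m B').
Proof.
apply/seteqP; split=> [y /(rowspaceP _ pE.1) yE|_ [x _ <-]].
  by exists y; rewrite // !mulmxA yE -mulmxA BB' mulmx1.
by rewrite /slice /= -!mulmxA (mulmxA E) EB; exists (x *m B); rewrite ?mulmxA.
Qed.

Lemma projector_slice : projector 2 (B *m E *m B').
Proof.
split; first by rewrite -!mulmxA (mulmxA B') (mulmxA E) (mulmxA E) EB (mulmxA E) pE.1.
by rewrite -mulmxA mxtrace_mulC EB pE.2.
Qed.

Lemma iso_slice : (B *m E *m B') *m Q *m (B *m E *m B')^T = 0.
Proof.
transitivity (B *m ((E *m B' *m B) *m J *m (E *m B' *m B)^T) *m B^T).
  by rewrite -BQ !trmx_mul !mulmxA.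
by rewrite EB isoE mulmx0 mul0mx.
Qed.
End Restrict.

Section Extend.
Variable P : 'M[A]_7.
Hypotheses (pP : projector 2 P) (isoP : P *m Q *m P^T = 0).
Local Notation E := (B' *m P *m B).

Lemma projector_extend : projector 2 E.
Proof.
split; last by rewrite -mulmxA mxtrace_mulC -mulmxA BB' mulmx1 pP.2.
by rewrite -!mulmxA (mulmxA B) BB' mul1mx (mulmxA P) pP.1.
Qed.

Lemma iso_extend : E *m J *m E^T = 0.
Proof.
transitivity (B' *m (P *m (B *m J *m B^T) *m P^T) *m B'^T).
  by rewrite !trmx_mul !mulmxA.
by rewrite BQ isoP mulmx0 mul0mx.
Qed.

Lemma orth_extend : E *m J *m t^T = 0.
Proof. by rewrite -!mulmxA (mulmxA B) Bt !mulmx0. Qed.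

Lemma slice_extend : slice (rowspace E) = rowspace P.
Proof.
rewrite (slice_rowspace projector_extend orth_extend).
by rewrite !mulmxA BB' mul1mx -mulmxA BB' mulmx1.
Qed.
End Extend.

End Slice.

Local Notation emb A := (map_mx (in_alg A)).

(** The map sends [U] to its annihilator, which lies in the orthogonal of [t], read in coordinates
    where the form is [Q]. The inverse embeds a plane by [B] and takes its annihilator. *)
Lemma zero_locus_isomorphic (Q : 'M[C]_7) (s : exterior C) :
    Q^T = Q -> Q \in unitmx -> Delta_plus s -> onorm (plus_row s) != 0 ->
  isomorphic (zero_locus s) (OG 2 Q).
Proof.
move=> QT uQ es s0; set t := plus_row s in s0.
have [B [B' [z [BQ Bt BB' B'B]]]] := spinor_hyperplane QT uQ s0.
have cQ (A : comAlgType C) : emb A B *m hyperbolic A *m (emb A B)^T = emb A Q.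
  by rewrite -map_VQ map_trmx -!map_mxM BQ.
have ct (A : comAlgType C) : emb A B *m hyperbolic A *m (emb A t)^T = 0.
  by rewrite -map_VQ map_trmx -!map_mxM Bt map_mx0.
have cBB' (A : comAlgType C) : emb A B *m emb A B' = 1%:M by rewrite -map_mxM BB' map_mx1.
have cB'B (A : comAlgType C) : emb A B' *m emb A B =
    1%:M - hyperbolic A *m (emb A t)^T *m emb A z.
  by rewrite -map_VQ map_trmx -!map_mxM B'B map_mxB map_mx1.
have orth (A : comAlgType C) (U : set 'rV[A]_(4 + 4)) : zero_locus_points s U ->
    exists E : 'M[A]_(4 + 4), [/\ annihilator U = rowspace E, projector 2 E,
      E *m hyperbolic A *m E^T = 0 & E *m hyperbolic A *m (emb A t)^T = 0].
  move=> /(zero_locus_pointsP _ es)[/OG8_pointsP[P [pP isoP ->]] orthU].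
  have /OG8_pointsP[E [pE isoE EE]] := annihilator_OG pP isoP.
  exists E; split=> //; apply/row_matrixP => k; rewrite !row_mul row0.
  by apply: orthU; rewrite EE; exists (delta_mx 0 k); rewrite ?rowE.
pose phi (A : comAlgType C) U := slice (emb A B) (annihilator U).
have phiE (A : comAlgType C) (U : set 'rV[A]_(4 + 4)) E : annihilator U = rowspace E ->
    projector 2 E -> E *m hyperbolic A *m (emb A t)^T = 0 ->
    phi A U = rowspace (emb A B *m E *m emb A B').
  by move=> UE pE Et; rewrite /phi UE (slice_rowspace (cBB' A) (cB'B A) pE Et).
exists phi; split=> [A|A A' f U Us].
  split.
  - move=> U /orth[E [UE pE isoE Et]]; apply/(OG_pointsP _ _ QT).
    exists (emb A B *m E *m emb A B'); split; last exact: phiE.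
      exact: (@projector_slice A _ _ _ _ (cB'B A) E pE Et).
    exact: (@iso_slice A _ _ _ _ _ (cQ A) (cB'B A) E isoE Et).
  (* Injectivity: the slice determines the annihilator, which in turn determines [U] by
     [annihilatorK]. *)
  - have sub U U' : zero_locus_points s U -> phi A U = phi A U' ->
        annihilator U `<=` annihilator U'.
      move=> /(zero_locus_pointsP _ es)[_ oU] phiU x Ux.
      have xB : x *m emb A B' *m emb A B = x.
        by rewrite -mulmxA cB'B mulmxBr mulmx1 !mulmxA oU // mul0mx subr0.
      have : phi A U' (x *m emb A B') by rewrite -phiU /phi /slice /= xB.
      by rewrite /phi /slice /= xB.
    move=> U U'; rewrite !inE => Us U's phiU.
    have [OGU OGU'] : OG_points 2 VQ U /\ OG_points 2 VQ U' by case: Us U's => ? _ [].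
    rewrite -(annihilatorK OGU) -(annihilatorK OGU'); congr annihilator.
    by apply/seteqP; split; exact: sub.
  - move=> Y /(OG_pointsP _ _ QT)[P [pP isoP YE]].
    set E := emb A B' *m P *m emb A B.
    have pE : projector 2 E by exact: (@projector_extend A _ _ (cBB' A) P pP).
    have isoE : E *m hyperbolic A *m E^T = 0.
      exact: (@iso_extend A _ _ _ (cQ A) P isoP).
    have OGL : OG_points 2 VQ (rowspace E) by apply/OG8_pointsP; exists E.
    have OGU := annihilator_OG pE isoE; exists (annihilator (rowspace E)).
      apply/(zero_locus_pointsP _ es); split=> //; rewrite (annihilatorK OGL).
      move=> _ [x _ <-].
      transitivity (x *m (E *m hyperbolic A *m (emb A t)^T)).
        by rewrite !mulmxA.
      by rewrite (@orth_extend A _ _ _ (ct A) P) mulmx0.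
    rewrite /phi (annihilatorK OGL) YE.
    exact: (@slice_extend A _ _ _ _ (ct A) (cBB' A) (cB'B A) P pP).
have [E [UE pE isoE Et]] := orth A U Us.
have OGU : OG_points 2 VQ U by case: Us.
(* Naturality: [B] and [B'] have constant entries, so slicing commutes with [f]. *)
have fE : emb A' B *m map_mx f E *m emb A' B' = map_mx f (emb A B *m E *m emb A B').
  by rewrite !map_mxM -!map_mx_comp; congr (_ *m _ *m _); apply/matrixP => i j;
    rewrite !mxE /= rmorph_alg.
rewrite (phiE A U E UE pE Et) rowspace_base_change -fE; apply: phiE.
- by rewrite annihilator_base_change // UE rowspace_base_change.
- exact: projector_map.
have -> : emb A' t = map_mx f (emb A t).
  by rewrite -map_mx_comp; apply/matrixP => i j; rewrite !mxE /= rmorph_alg.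
by rewrite -(map_hyperbolic f) map_trmx -!map_mxM Et map_mx0.
Qed.

End ZeroLocus.

Theorem proposition3 (R : realType) (Q : 'M[R[i]]_7)
    (Qsym : Q^T = Q) (Qnondeg : Q \in unitmx) :
  for_general_section (fun s : exterior R[i] => isomorphic (zero_locus s) (OG 2 Q)).
Proof.
(* The polynomial [p] is the quadratic form [onorm] on [Delta_+]; its nonvanishing cuts out the open
   set. *)
pose X (a b c d : bool) : {mpoly R[i][#|{set 'I_4}|]} :=
  'X_(enum_rank (subset_of_bits [:: a; b; c; d])).
pose p := X true true true true * X false false false false
  - X true true false false * X false false true true
  + X true false true false * X false true false true
  - X true false false true * X false true true false.
have pE (s : exterior R[i]) : p.@[fun k => s (enum_val k)] = onorm (plus_row s).
  rewrite /p !(mevalD, mevalN, mevalM, mevalXU) !enum_rankK.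
  by rewrite /onorm !entry_row8 //= mulrNN !mulNr.
exists [set s | Delta_plus s /\
  exists2 q, q \in [:: p] & q.@[fun k => s (enum_val k)] != 0].
split; first by exists [:: p].
(* The spinor [1 + e_0 /\ e_1 /\ e_2 /\ e_3], whose norm is 1. *)
- pose s : exterior R[i] := [ffun I : {set 'I_4} => (#|I| \in [:: 0; 4])%:R]%N.
  exists s; split; last first.
    exists p; rewrite ?mem_head // pE /onorm !entry_row8 //= !ffunE !card_bits /=.
    by rewrite !oppr0 !mul0r !addr0 mul1r oner_eq0.
  by move=> I oI; rewrite ffunE !inE; do 2?[case: eqP oI => [->//|_] oI].
move=> s [es [_ /[1!inE]/eqP-> ps]].
by apply: zero_locus_isomorphic; rewrite // -pE.
Qed.
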